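(* The $1$-skeleton of a Coxeter complex in $\mathbb{R}^d$ is a standard model; that is, if $X$ is the graph formed by the $1$-skeleton of a Coxeter complex in $\mathbb{R}^d$, then there is a lattice group $\mathcal{L}$ of translations preserving $X$, with $X_0=X/\mathcal{L}$ a finite graph, such that the inclusion $X\hookrightarrow\mathbb{R}^d$ is a standard realization of the topological crystal $X$ over $X_0$.
   Context: Coxeter complex. A Coxeter complex here means a triangulation of $\mathbb{R}^d$ such that, denoting by $\{\Delta_\alpha^d\}_{\alpha\in A}$ the set of its $d$-dimensional simplices: (a) the action of the group $\Gamma$ generated by all reflections fixing facets of the $\Delta_\alpha^d$ ($\alpha\in A$) preserves the triangulation; and (b) $\Gamma$ acts transitively on $\{\Delta_\alpha^d\}_{\alpha\in A}$. Graphs. A graph $X=(V,E)$ has vertex set $V$ and set $E$ of directed edges (each edge is counted with both directions); $o(e)$, $t(e)$, $\overline{e}$ denote origin, terminus and inverse of $e$. Loops and multiple edges are allowed. Homology. Let $X_0=(V_0,E_0)$ be a finite connected graph. $C_1(X_0,\mathbb{R})$ is the group of 1-chains (with $\overline{e}=-e$), with inner product $\langle e,e'\rangle=1$ if $e'=e$, $-1$ if $e'=\overline{e}$, $0$ otherwise. $H_1(X_0,\mathbb{R})=\ker\partial\subset C_1(X_0,\mathbb{R})$, where $\partial e=t(e)-o(e)$, carries the induced inner product. $P_0:C_1(X_0,\mathbb{R})\to H_1(X_0,\mathbb{R})$ is the orthogonal projection and ${\bf v}_0(e)=P_0(e)$. Topological crystals. $X_0^{\rm ab}$ is the maximal abelian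 covering graph of $X_0$ (covering transformation group $H_1(X_0,\mathbb{Z})$). A $d$-dimensional topological crystal over $X_0$ is an abelian covering graph $X$ of $X_0$ whose covering transformation group $L$ is free abelian of rank $d$; equivalently $X=X_0^{\rm ab}/H$ for a direct summand $H$ of $H_1(X_0,\mathbb{Z})$ (the vanishing subgroup) with $H_1(X_0,\mathbb{Z})/H=L$. Realizations. A periodic realization of $X$ is a piecewise linear map $\varPhi:X\to\mathbb{R}^d$ (each edge is mapped affinely to a segment) such that $\varPhi(\sigma x)=\varPhi(x)+\rho(\sigma)$ for $\sigma\in L$, where $\rho:L\to\mathbb{R}^d$ is an injective homomorphism whose image is a lattice. Its building cochain is ${\bf v}(e)=\varPhi(t(e))-\varPhi(o(e))$, an $L$-invariant function on $E$, hence a function on $E_0$; it determines $\varPhi$ up to translation. Standard realizations. Let $H_{\mathbb{R}}^{\perp}$ be the orthogonal complement in $H_1(X_0,\mathbb{R})$ of the span $H_{\mathbb{R}}$ of $H$; it has dimension $d$ and is identified with $\mathbb{R}^d$ by choosing an orthonormal basis. With $P:H_1(X_0,\mathbb{R})\to H_{\mathbb{R}}^{\perp}$ the orthogonal projection, the realization with building cochain ${\bf v}(e)=P({\bf v}_0(e))$ is the normalized standard realization of $X$. A standard realization is one obtained from the normalized one by composing with a similarity transformation of $\mathbb{R}^d$. *)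

(* Defs.v *)
From HB Require Import structures.
From Stdlib Require Export Relation_Operators.
From mathcomp Require Export all_boot all_order all_algebra.
From mathcomp Require Export finmap.
From mathcomp Require Export all_classical all_reals all_analysis.
Export numFieldNormedType.Exports.

Set Implicit Arguments.
Unset Strict Implicit.
Unset Printing Implicit Defensive.

Import Order.TTheory GRing.Theory Num.Theory.

Local Open Scope classical_set_scope.
Local Open Scope ring_scope.

(* The norm `|x| that the library puts on row vectors is the sup norm, so the
   Euclidean structure is spelled out. *)
Section Euclidean.
Context {R : realType} {d : nat}.
Implicit Types (x y n a : 'rV[R]_d) (L : set 'rV[R]_d).

Definition dot x y : R := \sum_i x 0 i * y 0 i.

Definition enorm x : R := Num.sqrt (dot x x).

Definition reflection a n x := x - (2 * dot (x - a) n / dot n n) *: n.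

Definition is_reflection (f : 'rV[R]_d -> 'rV[R]_d) :=
  exists2 n, n != 0 & exists a, f = reflection a n.

Definition similarity (S : 'rV[R]_d -> 'rV[R]_d) :=
  exists2 k : R, 0 < k & forall x y, enorm (S x - S y) = k * enorm (x - y).

Definition is_lattice L :=
  exists2 B : 'M[R]_d, B \in unitmx &
    L = [set map_mx intr z *m B | z in [set: 'rV[int]_d]].

End Euclidean.

Section Triangulation.
Context {R : realType} {d : nat}.
Implicit Types s t f : {fset 'rV[R]_d}.

Definition aff_indep s := forall c : 'rV[R]_d -> R,
  \sum_(v <- s) c v = 0 -> \sum_(v <- s) c v *: v = 0 ->
  forall v, v \in s -> c v = 0.

(* hull fset0 = set0, since an empty sum is not 1 *)
Definition hull s : set 'rV[R]_d := [set x | exists c : 'rV[R]_d -> R,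
  [/\ forall v, v \in s -> 0 <= c v, \sum_(v <- s) c v = 1 &
      x = \sum_(v <- s) c v *: v]].

End Triangulation.

(* A simplex is encoded by its finite vertex set. *)
Record triangulation (R : realType) (d : nat) := Triangulation {
  simplices :> {fset 'rV[R]_d} -> Prop;
  tri_neq0 : forall s, simplices s -> s != fset0;
  tri_indep : forall s, simplices s -> aff_indep s;
  tri_face : forall s t, simplices s -> (t `<=` s)%fset -> t != fset0 ->
    simplices t;
  tri_meet : forall s t, simplices s -> simplices t ->
    hull s `&` hull t = hull (s `&` t)%fset;
  tri_cover : forall x, exists2 s, simplices s & hull s x;
  tri_locfin : forall x : 'rV[R]_d, exists2 U, nbhs x U &
    finite_set [set s | simplices s /\ hull s `&` U !=set0] }.

Section Coxeter.
Context {R : realType} {d : nat}.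
Implicit Types (T : triangulation R d) (s f : {fset 'rV[R]_d}).

Definition top_simplex T s := T s /\ #|` s| = d.+1.

Definition facet_reflection T (g : 'rV[R]_d -> 'rV[R]_d) :=
  is_reflection g /\ exists s f, [/\ top_simplex T s, (f `<=` s)%fset,
    #|` f| = d & forall v, v \in f -> g v = v].

Inductive generated (E : Type) (S : set (E -> E)) : (E -> E) -> Prop :=
| Gen_id : generated S id
| Gen_in g : S g -> generated S g
| Gen_comp g h : generated S g -> generated S h -> generated S (g \o h)
| Gen_inv g h : generated S g -> cancel g h -> cancel h g -> generated S h.

Definition Gamma T := generated (facet_reflection T).

Definition act_simplex (g : 'rV[R]_d -> 'rV[R]_d) s := [fset g v | v in s]%fset.

Definition coxeter_complex T :=
  (forall g s, Gamma T g -> T s -> T (act_simplex g s)) /\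
  (forall s t, top_simplex T s -> top_simplex T t ->
     exists2 g, Gamma T g & act_simplex g s = t).

End Coxeter.

Record graph := Graph {
  vert : Type;
  edge : Type;
  org : edge -> vert;
  ter : edge -> vert;
  inv : edge -> edge;
  inv_inv : forall e, inv (inv e) = e;
  org_inv : forall e, org (inv e) = ter e;
  inv_neq : forall e, inv e <> e }.

Record fgraph := FGraph {
  fvert : finType;
  fedge : finType;
  forg : fedge -> fvert;
  fter : fedge -> fvert;
  finv : fedge -> fedge;
  finv_inv : forall e, finv (finv e) = e;
  forg_inv : forall e, forg (finv e) = fter e;
  finv_neq : forall e, finv e <> e }.

Coercion graph_of_fgraph (X : fgraph) : graph :=
  Graph (@finv_inv X) (@forg_inv X) (@finv_neq X).

Record gmor (X Y : graph) := GMor {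
  mv : vert X -> vert Y;
  me : edge X -> edge Y;
  mor_org : forall e, org (me e) = mv (org e);
  mor_ter : forall e, ter (me e) = mv (ter e);
  mor_inv : forall e, inv (me e) = me (inv e) }.

Lemma gcomp_org X Y Z (g : gmor Y Z) (f : gmor X Y) e :
  org (me g (me f e)) = mv g (mv f (org e)).
Proof. by rewrite !mor_org. Qed.

Lemma gcomp_ter X Y Z (g : gmor Y Z) (f : gmor X Y) e :
  ter (me g (me f e)) = mv g (mv f (ter e)).
Proof. by rewrite !mor_ter. Qed.

Lemma gcomp_inv X Y Z (g : gmor Y Z) (f : gmor X Y) e :
  inv (me g (me f e)) = me g (me f (inv e)).
Proof. by rewrite !mor_inv. Qed.

Definition gcomp X Y Z (g : gmor Y Z) (f : gmor X Y) : gmor X Z :=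
  @GMor X Z (mv g \o mv f) (me g \o me f)
    (gcomp_org g f) (gcomp_ter g f) (gcomp_inv g f).

Definition adjacent (X : graph) (x y : vert X) :=
  exists e : edge X, org e = x /\ ter e = y.

Definition connected_graph (X : graph) :=
  inhabited (vert X) /\ forall x y : vert X, clos_refl_trans _ (@adjacent X) x y.

Definition automorphism (X : graph) (f : gmor X X) :=
  bijective (mv f) /\ bijective (me f).

Definition covering_map (X Y : graph) (p : gmor X Y) :=
  (forall y, exists x, mv p x = y) /\
  (forall x (e' : edge Y), org e' = mv p x ->
     exists! e : edge X, org e = x /\ me p e = e').

Definition deck (X Y : graph) (p : gmor X Y) : set (gmor X X) :=
  [set f | [/\ automorphism f, forall x, mv p (mv f x) = mv p x &
              forall e, me p (me f e) = me p e]].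

(* Y is the quotient X/G up to isomorphism: the fibres of q are the G-orbits. *)
Definition quotient_map (X Y : graph) (G : set (gmor X X)) (q : gmor X Y) :=
  [/\ forall y, exists x, mv q x = y,
      forall e', exists e, me q e = e',
      forall x x', mv q x = mv q x' <-> exists2 f, G f & mv f x = x' &
      forall e e', me q e = me q e' <-> exists2 f, G f & me f e = e'].

Definition free_abelian_of_rank (d : nat) (X : graph) (G : set (gmor X X)) :=
  exists phi : 'rV[int]_d -> gmor X X,
    [/\ injective phi, range phi = G &
        forall a b, phi (a + b) = gcomp (phi a) (phi b)].

Definition topological_crystal (d : nat) (X : graph) (X0 : fgraph)
    (p : gmor X X0) :=
  [/\ connected_graph X0, connected_graph X, covering_map p,
      forall x x', mv p x = mv p x' -> exists2 f, deck p f & mv f x = x' &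
      free_abelian_of_rank d (deck p)].

(* A 1-chain is encoded by its coefficients: c e is the coefficient of e, and
   the relation (inverse of e) = - e makes the coefficient function odd. *)
Section Homology.
Variables (A : comPzRingType) (X0 : fgraph).
Implicit Type c : {ffun fedge X0 -> A}.

Definition is_chain c := forall e, c (finv e) = - c e.

Definition chain1 (e : fedge X0) : {ffun fedge X0 -> A} :=
  [ffun e' => (e' == e)%:R - (e' == finv e)%:R].

(* As c is odd, the sum over the edges ending at v also accounts for the edges
   starting at v: each unoriented edge contributes c e * (t(e) - o(e)). *)
Definition bd c (v : fvert X0) : A := \sum_(e | fter e == v) c e.

Definition H1 : set {ffun fedge X0 -> A} :=
  [set c | is_chain c /\ forall v, bd c v = 0].

Lemma is_chainD c c' : is_chain c -> is_chain c' -> is_chain (c + c').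
Proof. by move=> hc hc' e; rewrite !ffunE hc hc' opprD. Qed.

Lemma chain1_chain e : is_chain (chain1 e).
Proof.
move=> e'; rewrite !ffunE opprB (can2_eq (@finv_inv X0) (@finv_inv X0)).
by rewrite (inj_eq (can_inj (@finv_inv X0))).
Qed.

Lemma bdD c c' v : bd (c + c') v = bd c v + bd c' v.
Proof. by rewrite /bd -big_split; apply: eq_bigr => e _; rewrite ffunE. Qed.

Lemma bd_chain1 e v :
  bd (chain1 e) v = (v == fter e)%:R - (v == forg e)%:R.
Proof.
have sumE f : \sum_(e' | fter e' == v) (e' == f)%:R = (v == fter f)%:R :> A.
  rewrite big_mkcond (bigD1 f) //= eqxx eq_sym big1 ?addr0; first by case: ifP.
  by move=> i /negPf ->; rewrite if_same.
rewrite /bd (eq_bigr (fun e' => (e' == e)%:R - (e' == finv e)%:R)); last first.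
  by move=> e' _; rewrite ffunE.
by rewrite sumrB !sumE -[fter (finv e)]forg_inv finv_inv.
Qed.

Lemma chain1_inv e : chain1 (finv e) = - chain1 e.
Proof. by apply/ffunP => e'; rewrite !ffunE finv_inv opprB. Qed.

End Homology.

Arguments chain1 A {X0} e.

(* A vertex over v is the homology class of a path from the base point b to v,
   that is, an integral 1-chain c with boundary v - b; the edge over e starting
   at (o(e), c) ends at (t(e), c + e).  A homology class h maps (v, c) to
   (v, c + h). *)
Section MaximalAbelianCover.
Variables (X0 : fgraph) (b : fvert X0).

Definition ab_path (v : fvert X0) (c : {ffun fedge X0 -> int}) :=
  is_chain c /\ forall w, bd c w = (w == v)%:R - (w == b)%:R.

Definition ab_vert :=
  {x : fvert X0 * {ffun fedge X0 -> int} | ab_path x.1 x.2}.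

Definition ab_edge :=
  {x : fedge X0 * {ffun fedge X0 -> int} | ab_path (forg x.1) x.2}.

Lemma ab_path_ter e c :
  ab_path (forg e) c -> ab_path (fter e) (c + chain1 int e).
Proof.
move=> [hc hb]; split; first exact: is_chainD hc (chain1_chain _ _).
by move=> w; rewrite bdD hb bd_chain1 addrC addrA subrK.
Qed.

Lemma ab_path_inv e c :
  ab_path (forg e) c -> ab_path (forg (finv e)) (c + chain1 int e).
Proof. by rewrite forg_inv; exact: ab_path_ter. Qed.

Definition ab_org (x : ab_edge) : ab_vert :=
  exist (fun y => ab_path y.1 y.2) (forg (sval x).1, (sval x).2) (svalP x).

Definition ab_ter (x : ab_edge) : ab_vert :=
  exist (fun y => ab_path y.1 y.2)
    (fter (sval x).1, (sval x).2 + chain1 int (sval x).1)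
    (ab_path_ter (svalP x)).

Definition ab_inv (x : ab_edge) : ab_edge :=
  exist (fun y => ab_path (forg y.1) y.2)
    (finv (sval x).1, (sval x).2 + chain1 int (sval x).1)
    (ab_path_inv (svalP x)).

Lemma ab_inv_inv x : ab_inv (ab_inv x) = x.
Proof.
by case: x => -[e c] h; apply: eq_exist; rewrite /= finv_inv chain1_inv addrK.
Qed.

Lemma ab_org_inv x : ab_org (ab_inv x) = ab_ter x.
Proof. by apply: eq_exist; rewrite /= forg_inv. Qed.

Lemma ab_inv_neq x : ab_inv x <> x.
Proof. by move/(congr1 (fun y : ab_edge => (sval y).1))/finv_neq. Qed.

Definition maxab : graph := Graph ab_inv_inv ab_org_inv ab_inv_neq.

Lemma ab_proj_ter (e : edge maxab) : fter (sval e).1 = (sval (ter e)).1.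
Proof. by []. Qed.

Definition ab_proj : gmor maxab X0 :=
  @GMor maxab X0 (fun x => (sval x).1) (fun x => (sval x).1)
    (fun=> erefl) ab_proj_ter (fun=> erefl).

Definition ab_translations (H : set {ffun fedge X0 -> int}) :
    set (gmor maxab maxab) :=
  [set f : gmor maxab maxab | exists2 h, H h &
     (forall x : ab_vert, sval (mv f x : ab_vert) = ((sval x).1, (sval x).2 + h)) /\
     (forall e : ab_edge, sval (me f e : ab_edge) = ((sval e).1, (sval e).2 + h))].

End MaximalAbelianCover.

Definition subgroup (V : zmodType) (H : set V) :=
  H 0 /\ forall x y, H x -> H y -> H (x - y).

Definition direct_summand (V : zmodType) (M H : set V) :=
  [/\ subgroup H, H `<=` M & exists K : set V,
    [/\ subgroup K, K `<=` M, H `&` K = [set 0] &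
        forall x, M x -> exists h k, [/\ H h, K k & x = h + k]]].

Definition vanishing_subgroup (X : graph) (X0 : fgraph) (p : gmor X X0)
    (H : set {ffun fedge X0 -> int}) :=
  direct_summand (@H1 int X0) H /\
  exists (b : fvert X0) (q : gmor (maxab b) X),
    gcomp p q = ab_proj b /\ quotient_map (@ab_translations X0 b H) q.

Section StandardRealization.
Variables (R : realType) (d : nat).

(* A piecewise linear map from a graph to R^d is determined by its values on
   the vertices, so realizations are encoded as maps on the vertices. *)
Definition periodic_realization (X : graph) (X0 : fgraph) (p : gmor X X0)
    (Phi : vert X -> 'rV[R]_d) :=
  exists rho : gmor X X -> 'rV[R]_d,
    [/\ forall f g, deck p f -> deck p g -> rho (gcomp f g) = rho f + rho g,
        {in deck p &, injective rho},
        is_lattice (rho @` deck p) &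
        forall f x, deck p f -> Phi (mv f x) = Phi x + rho f].

Section Chains.
Variable X0 : fgraph.
Local Notation C := {ffun fedge X0 -> R}.
Implicit Types (c w : C) (W : set C).

(* Each unoriented edge occurs twice in the sum. *)
Definition cdot c c' : R := 2^-1 * \sum_e c e * c' e.

(* The default value 0 is never used when W is a linear subspace. *)
Definition orth_proj W c : C :=
  xget 0 [set w | W w /\ forall w', W w' -> cdot (c - w) w' = 0].

Definition real_span (H : set {ffun fedge X0 -> int}) : set C :=
  [set c | exists n (r : 'I_n -> R) (h : 'I_n -> {ffun fedge X0 -> int}),
     (forall i, H (h i)) /\
     c = \sum_(i < n) r i *: [ffun e => (h i e)%:~R]].

Definition orth_compl (H : set {ffun fedge X0 -> int}) : set C :=
  [set c | @H1 R X0 c /\ forall h, real_span H h -> cdot c h = 0].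

Definition orthonormal_basis W (u : 'I_d -> C) :=
  [/\ forall i, W (u i), forall i j, cdot (u i) (u j) = (i == j)%:R &
      forall w, W w -> exists a : 'I_d -> R, w = \sum_i a i *: u i].

Definition coords (u : 'I_d -> C) w : 'rV[R]_d := \row_i cdot w (u i).

Definition standard_cochain H (u : 'I_d -> C) (e : fedge X0) : 'rV[R]_d :=
  coords u (orth_proj (orth_compl H) (orth_proj (@H1 R X0) (chain1 R e))).

End Chains.

Definition normalized_standard_realization (X : graph) (X0 : fgraph)
    (p : gmor X X0) (Phi : vert X -> 'rV[R]_d) :=
  periodic_realization p Phi /\
  exists (H : set {ffun fedge X0 -> int}) (u : 'I_d -> {ffun fedge X0 -> R}),
    [/\ vanishing_subgroup p H, orthonormal_basis (orth_compl H) u &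
        forall e : edge X,
          Phi (ter e) - Phi (org e) = standard_cochain H u (me p e)].

Definition standard_realization (X : graph) (X0 : fgraph) (p : gmor X X0)
    (Phi : vert X -> 'rV[R]_d) :=
  exists Phi0 S, [/\ normalized_standard_realization p Phi0, similarity S &
                     Phi = S \o Phi0].

End StandardRealization.

Section Skeleton.
Context {R : realType} {d : nat}.
Variable T : triangulation R d.

Definition skel_vert := {x : 'rV[R]_d | T [fset x]%fset}.

Definition skel_edge :=
  {xy : 'rV[R]_d * 'rV[R]_d | xy.1 != xy.2 /\ T [fset xy.1; xy.2]%fset}.

Lemma skel_org_subproof (e : skel_edge) : T [fset (sval e).1]%fset.
Proof.
case: e => -[x y] /= [_ h]; apply: (tri_face h).
  by rewrite fsub1set !inE eqxx.
by apply/fset0Pn; exists x; rewrite inE.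
Qed.

Lemma skel_ter_subproof (e : skel_edge) : T [fset (sval e).2]%fset.
Proof.
case: e => -[x y] /= [_ h]; apply: (tri_face h).
  by rewrite fsub1set !inE eqxx orbT.
by apply/fset0Pn; exists y; rewrite inE.
Qed.

Lemma skel_inv_subproof (e : skel_edge) :
  (sval e).2 != (sval e).1 /\ T [fset (sval e).2; (sval e).1]%fset.
Proof. by case: e => -[x y] /= [xy h]; rewrite eq_sym fsetUC. Qed.

Definition skel_org (e : skel_edge) : skel_vert :=
  exist (fun x => T [fset x]%fset) (sval e).1 (skel_org_subproof e).

Definition skel_ter (e : skel_edge) : skel_vert :=
  exist (fun x => T [fset x]%fset) (sval e).2 (skel_ter_subproof e).

Definition skel_inv (e : skel_edge) : skel_edge :=
  exist (fun xy => xy.1 != xy.2 /\ T [fset xy.1; xy.2]%fset)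
    ((sval e).2, (sval e).1) (skel_inv_subproof e).

Lemma skel_inv_inv e : skel_inv (skel_inv e) = e.
Proof. by case: e => -[x y] h; apply: eq_exist. Qed.

Lemma skel_org_inv e : skel_org (skel_inv e) = skel_ter e.
Proof. exact: eq_exist. Qed.

Lemma skel_inv_neq e : skel_inv e <> e.
Proof.
case: e => -[x y] [/= xy h] /(congr1 (fun e : skel_edge => (sval e).1)) /= yx.
by rewrite yx eqxx in xy.
Qed.

Definition skeleton : graph := Graph skel_inv_inv skel_org_inv skel_inv_neq.

Definition inclusion (x : vert skeleton) : 'rV[R]_d := sval x.

(* An edge of the skeleton is determined by its end points, hence so is a
   morphism by its action on the vertices. *)
Definition is_translation (l : 'rV[R]_d) (f : gmor skeleton skeleton) :=
  forall x, inclusion (mv f x) = inclusion x + l.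

Definition translations (L : set 'rV[R]_d) : set (gmor skeleton skeleton) :=
  [set f | exists2 l, L l & is_translation l f].

Definition translations_preserve (L : set 'rV[R]_d) :=
  forall l, L l -> exists2 f, automorphism f & is_translation l f.

End Skeleton.

Arguments translations {R d} T L.

(* Main.v *)
Require Import Defs.
From mathcomp Require Import ring zify.

(** Why the theorem holds.  Let Gamma be the group of the complex T, let s be a
chamber (a simplex of dimension d), and let L be the group of translations in
Gamma.

L is a lattice.  A reflection of Gamma that fixes a point of s moves some
vertex v of s to a vertex z of a simplex meeting s, and its unit normal is
z - v up to scale, so there are finitely many such normals ([local_root]).  Two
mirrors that are not parallel meet, and an element of Gamma moves a common
point into s; hence the inner products of the unit normals of all mirrors take
finitely many values ([dot_roots]).  As the normals of the walls of s span the
space, the set of all normals is finite ([roots_finite]), and so is the set of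
linear parts of elements of Gamma, because it permutes the normals
([linear_parts_finite]).  A linear form that vanishes on L is then bounded on
the orbit of s, which is the whole space, so L spans ([translation_span]).  It
is discrete since T is locally finite, and a discrete spanning subgroup has a
basis ([discrete_subgroup_is_lattice]).

The crystal.  The simplices of T are connected through common vertices and
L permutes them, so the skeleton is a connected covering of a finite graph X0
with deck group L.  To a cycle of X0 belongs the translation between the ends of
its lifts; the cycles with zero displacement form the vanishing subgroup H, and
the maximal abelian cover maps onto the skeleton with the orbits of the
translations by H as fibres ([vanishing_is_vanishing_subgroup]).

The realization is standard.  Let vec e be the vector of an edge e of X0.
Two identities are needed: the vectors of the edges at a vertex add up to 0
([harmonic]), and the sum of the operators y |-> <y, vec e> vec e is a
multiple of the identity ([tight_frame]).  The first sum is invariant under the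
reflections in the d walls of a chamber through the vertex, hence orthogonal to
d independent normals.  The second operator commutes with the reflections in
the walls of s, so the normals of the d + 1 walls are eigenvectors; their only
linear relation has nonzero coefficients, so the eigenvalues agree.  The
identities say that, up to a factor k, the coordinates of vec are orthonormal
cycles u_i in H_1(X0, R).  They are orthogonal to H, and a cycle orthogonal
to all of them is a real combination of elements of H
([orth_frame_real_span]), so they form a basis of the orthogonal complement of
H.  The coordinates of the projection of e on this complement are
<e, u_i> = k (vec e)_i, which is the building cochain of the inclusion scaled
by k ([standard_cochainE]). *)

Set Implicit Arguments.
Unset Strict Implicit.
Unset Printing Implicit Defensive.
Import Order.TTheory GRing.Theory Num.Theory.
Local Open Scope classical_set_scope.
Local Open Scope ring_scope.

(** * Euclidean vectors and lattices *)

Section Dot.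
Context {R : realType} {d : nat}.
Implicit Types x y z : 'rV[R]_d.

Lemma dotE x y : dot x y = (x *m y^T) 0 0.
Proof. by rewrite mxE; apply: eq_bigr => i _; rewrite mxE. Qed.

Lemma dotC x y : dot x y = dot y x.
Proof. by apply: eq_bigr => i _; rewrite mulrC. Qed.

Lemma dotDl x y z : dot (x + y) z = dot x z + dot y z.
Proof. by rewrite !dotE mulmxDl mxE. Qed.

Lemma dotZl a x z : dot (a *: x) z = a * dot x z.
Proof. by rewrite !dotE -scalemxAl mxE. Qed.

Lemma dotNl x z : dot (- x) z = - dot x z.
Proof. by rewrite -scaleN1r dotZl mulN1r. Qed.

Lemma dotBl x y z : dot (x - y) z = dot x z - dot y z.
Proof. by rewrite dotDl dotNl. Qed.

Lemma dot0l z : dot 0 z = 0.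
Proof. by rewrite dotE mul0mx mxE. Qed.

Lemma dotZr a x z : dot z (a *: x) = a * dot z x.
Proof. by rewrite !(dotC z) dotZl. Qed.

Lemma dotNr x z : dot z (- x) = - dot z x.
Proof. by rewrite !(dotC z) dotNl. Qed.

Lemma dot0r z : dot z 0 = 0.
Proof. by rewrite dotC dot0l. Qed.

Lemma dot_suml (I : Type) (r : seq I) (P : pred I) (F : I -> 'rV[R]_d) z :
  dot (\sum_(i <- r | P i) F i) z = \sum_(i <- r | P i) dot (F i) z.
Proof. exact: (big_morph (dot^~ z) (fun x y => dotDl x y z) (dot0l z)). Qed.

Lemma dot_ge0 x : 0 <= dot x x.
Proof. by apply: sumr_ge0 => i _; rewrite -expr2 sqr_ge0. Qed.

Lemma dot_eq0 x : (dot x x == 0) = (x == 0).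
Proof.
apply/idP/eqP => [|->]; last by rewrite dot0l.
rewrite psumr_eq0; last by move=> i _; rewrite -expr2 sqr_ge0.
move=> /allP x0; apply/rowP => i; rewrite mxE.
by move: (x0 i (mem_index_enum i)); rewrite /= mulf_eq0 orbb => /eqP.
Qed.

Lemma dot_gt0 x : (0 < dot x x) = (x != 0).
Proof. by rewrite lt_def dot_ge0 dot_eq0 andbT. Qed.

Lemma dot_mulmx x y (M : 'M[R]_d) : dot (x *m M) y = dot x (y *m M^T).
Proof. by rewrite !dotE trmx_mul trmxK mulmxA. Qed.

Lemma dot_orthogonal x y (M : 'M[R]_d) : M *m M^T = 1%:M ->
  dot (x *m M) (y *m M) = dot x y.
Proof. by move=> MM; rewrite dot_mulmx -mulmxA MM mulmx1. Qed.

(** As long as fewer than d independent rows have been chosen, some nonzero y is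
orthogonal to them, and an x in S that is not orthogonal to y can be added. *)
Lemma basis_of_spanning (S : set 'rV[R]_d) :
  (forall y, (forall x, S x -> dot x y = 0) -> y = 0) ->
  exists2 M : 'M[R]_d, M \in unitmx & forall i, S (row i M).
Proof.
move=> Sspan.
have free k : (k <= d)%N ->
    exists2 A : 'M[R]_(k, d), row_free A & forall i, S (row i A).
  elim: k => [_|k IH kd].
    exists 0; last by case.
    by apply: inj_row_free => v _; apply/rowP; case.
  have [A Afree SA] := IH (ltnW kd).
  have : kermx A^T != 0.
    rewrite -mxrank_eq0 mxrank_ker mxrank_tr (eqP Afree) subn_eq0 -ltnNge //.
  case/rowV0Pn => y /sub_kermxP yA y0.
  have [x Sx xy] : exists2 x, S x & dot x y != 0.
    apply: contrapT => /forall2NP h; case/eqP: y0; apply: Sspan => x Sx.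
    by apply/eqP; case: (h x) => // /negP; rewrite negbK.
  exists (col_mx x A : 'M[R]_(1 + k, d)).
    apply: (@inj_row_free _ (1 + k)) => v; rewrite -[v]hsubmxK mul_row_col => v0.
    have Ay : A *m y^T = 0 by rewrite -[A *m _]trmxK trmx_mul trmxK yA trmx0.
    have vl : @lsubmx _ _ 1 k v = 0.
      have : (lsubmx v) 0 0 * dot x y = 0.
        have := congr1 (fun w => (w *m y^T) 0 0) v0.
        by rewrite mulmxDl -!mulmxA Ay mulmx0 addr0 mul0mx mxE big_ord1 -dotE [RHS]mxE.
      move=> /eqP; rewrite mulf_eq0 (negPf xy) orbF => /eqP v00.
      by apply/rowP => i; rewrite ord1 v00 [RHS]mxE.
    move: v0; rewrite vl mul0mx add0r => v0.
    have -> : @rsubmx _ _ 1 k v = 0 by apply: (row_free_inj Afree); rewrite v0 mul0mx.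
    by rewrite row_mx0.
  have rows (i : 'I_(1 + k)) : S (row i (col_mx x A)).
    case: (split_ordP i) => j ->; last by rewrite rowKd.
    rewrite rowKu; suff -> : row j x = x by [].
    by apply/rowP => l; rewrite ord1 !mxE.
  exact: rows.
have [M Mfree SM] := free d (leqnn d).
by exists M; rewrite // -row_free_unit.
Qed.

End Dot.


Section Subgroup.
Variables (V : zmodType) (H : set V).
Hypothesis subH : subgroup H.

Lemma subgroupN x : H x -> H (- x).
Proof. by move=> Hx; rewrite -sub0r; apply: subH.2 => //; exact: subH.1. Qed.

Lemma subgroupD x y : H x -> H y -> H (x + y).
Proof. by move=> Hx Hy; rewrite -[y]opprK; apply/subH.2/subgroupN. Qed.

Lemma subgroup_sum (I : Type) (r : seq I) (P : pred I) (F : I -> V) :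
  (forall i, P i -> H (F i)) -> H (\sum_(i <- r | P i) F i).
Proof. by move=> HF; apply: big_ind => //; [exact: subH.1|exact: subgroupD]. Qed.

Lemma subgroupMz x n : H x -> H (x *~ n).
Proof.
have nat_mul k : H x -> H (x *+ k).
  move=> Hx; elim: k => [|k IH]; first by rewrite mulr0n; exact: subH.1.
  by rewrite mulrS; apply: subgroupD.
by case: n => n Hx; [exact: nat_mul|apply/subgroupN/nat_mul].
Qed.

End Subgroup.

Lemma morph_mulrz (U V : zmodType) (f : U -> V) :
  {morph f : x y / x + y} -> forall x n, f (x *~ n) = f x *~ n.
Proof.
move=> fD; have f0 : f 0 = 0 by apply: (addrI (f 0)); rewrite -fD !addr0.
have fN x : f (- x) = - f x by apply: (addrI (f x)); rewrite -fD !subrr.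
have fMn x m : f (x *+ m) = f x *+ m.
  by elim: m => [|m IH]; rewrite ?mulr0n // !mulrS fD IH.
by move=> x [n|n]; rewrite ?NegzE ?mulrNz ?fN -!pmulrn fMn.
Qed.

Section IntegerLattice.
Variable d : nat.

(** Cramer's rule: the coordinates of a in the basis of the rows of Z, up to the
factor det Z, as determinants. *)
Lemma det_replace_row (Z : 'M[int]_d) (a : 'rV[int]_d) i :
  \det (\matrix_k (if k == i then a else row k Z)) = (a *m \adj Z) 0 i.
Proof.
rewrite (expand_det_row _ i) mxE; apply: eq_bigr => j _.
rewrite !mxE eqxx; congr (_ * (_ * \det _)); apply/matrixP => k l.
by rewrite !mxE eq_sym (negPf (neq_lift _ _)) mxE.
Qed.

(** A choice of rows in A with the least nonzero |det| is a basis of A: if a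
coordinate of some a in A with respect to it were not an integer, replacing a row
by the remainder of a would give a smaller nonzero determinant. *)
Lemma integer_sublattice_basis (A : set 'rV[int]_d) :
  subgroup A ->
  (exists2 M : 'M[int]_d, \det M != 0 & forall i, A (row i M)) ->
  exists2 Z : 'M[int]_d, \det Z != 0 & A = [set z *m Z | z in [set: 'rV[int]_d]].
Proof.
move=> subA [M M0 AM].
pose P k := `[< exists Z : 'M[int]_d,
  [/\ \det Z != 0, forall i, A (row i Z) & absz (\det Z) = k] >].
have exP : exists k, P k by exists (absz (\det M)); apply/asboolP; exists M.
case: (ex_minnP exP) => k /asboolP [Z [Z0 AZ <-]] Zmin.
exists Z => //; apply/seteqP; split => [a Aa|_ [z _ <-]]; last first.
  rewrite mulmx_sum_row; apply: subgroup_sum => // i _.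
  by rewrite -[z 0 i]intz scaler_int; apply: subgroupMz.
pose c i := (a *m \adj Z) 0 i.
have dvd i : (\det Z %| c i)%Z.
  (* The i-th coordinate of a', times det Z, is the remainder of c i. *)
  pose a' := a - (c i %/ \det Z)%Z *: row i Z.
  have Aa' : A a'.
    apply: subA.2 => //; rewrite -[X in X *: _]intz scaler_int.
    exact: subgroupMz.
  have det' : (a' *m \adj Z) 0 i = (c i %% \det Z)%Z.
    rewrite mulmxBl -scalemxAl -row_mul mul_mx_adj /modz /c.
    by rewrite !mxE eqxx mulr1n.
  apply/dvdz_mod0P/eqP/negPn/negP => c0.
  have : P (absz (c i %% \det Z)%Z).
    apply/asboolP; exists (\matrix_k (if k == i then a' else row k Z)).
    rewrite det_replace_row det'; split => // j; rewrite rowK.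
    by case: ifP.
  move=> /Zmin; have := ltz_mod (c i) Z0; have := modz_ge0 (c i) Z0.
  by lia.
exists (\row_i (c i %/ \det Z)%Z) => //.
set q := \row_i _.
have E : \det Z *: (q *m Z) = \det Z *: a.
  rewrite scalemxAl -[RHS]mul_mx_scalar -mul_adj_mx mulmxA; congr (_ *m _).
  by apply/rowP => i; rewrite [LHS]mxE [X in _ * X]mxE mulrC divzK.
apply/rowP => i; apply: (mulfI Z0).
by have := congr1 (fun w : 'rV_d => w 0 i) E; rewrite mxE => ->; rewrite mxE.
Qed.

End IntegerLattice.

Section RealLattice.
Context {R : realType} {d : nat}.
Implicit Types (B : 'M[R]_d) (x : 'rV[R]_d) (z : 'rV[int]_d).

Definition lat B z : 'rV[R]_d := map_mx intr z *m B.

(** The fundamental domain of the lattice is the set of zeros of this function. *)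
Definition lat_floor B x : 'rV[int]_d :=
  \row_i Num.floor ((x *m invmx B) 0 i).

Lemma latD B z z' : lat B (z + z') = lat B z + lat B z'.
Proof. by rewrite /lat map_mxD mulmxDl. Qed.

Lemma lat0 B : lat B 0 = 0.
Proof. by rewrite /lat map_mx0 mul0mx. Qed.

Lemma latN B z : lat B (- z) = - lat B z.
Proof. by rewrite /lat map_mxN mulNmx. Qed.

Lemma latB B z z' : lat B (z - z') = lat B z - lat B z'.
Proof. by rewrite latD latN. Qed.

Lemma lat_inj B : B \in unitmx -> injective (lat B).
Proof.
move=> Bu z z' /(congr1 (mulmx^~ (invmx B))); rewrite /lat !mulmxK //.
by move=> /rowP h; apply/rowP => i; have := h i; rewrite !mxE => /intr_inj.
Qed.

Lemma lat_floorD B x z : B \in unitmx ->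
  lat_floor B (x + lat B z) = lat_floor B x + z.
Proof.
move=> Bu; apply/rowP => i.
by rewrite mxE mulmxDl mulmxK // !mxE floorDrz ?intr_int // intrKfloor.
Qed.

Lemma lat_floor_sub B x : B \in unitmx ->
  lat_floor B (x - lat B (lat_floor B x)) = 0.
Proof. by move=> Bu; rewrite -latN lat_floorD // subrr. Qed.

Lemma lat_rows (S : set 'rV[R]_d) B z : subgroup S -> (forall i, S (row i B)) ->
  S (lat B z).
Proof.
move=> subS SB; rewrite /lat mulmx_sum_row; apply: subgroup_sum => // i _.
by rewrite mxE scaler_int; apply: subgroupMz.
Qed.

Lemma fund_domain_bounded B x i : B \in unitmx -> lat_floor B x = 0 ->
  `|x 0 i| <= \sum_j \sum_k `|B j k|.
Proof.
move=> Bu x0; rewrite -[x](mulmxKV Bu) mxE; apply: le_trans (ler_norm_sum _ _ _) _.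
apply: ler_sum => j _; rewrite normrM.
have : lat_floor B x 0 j = 0 by rewrite x0 mxE.
rewrite mxE => /eqP; rewrite floor_eq => /andP [c0 c1].
apply: (@le_trans _ _ `|B j i|); last by rewrite (bigD1 i) //= lerDl sumr_ge0.
by rewrite ler_piMl // ger0_norm // ltW.
Qed.

(** By the pigeonhole principle, applied to the multiples of an element of S modulo
the lattice M spanned by the rows of B0, there is an N with N S contained in M;
so S lies between M and M / N, and the integral case applies. *)
Lemma discrete_subgroup_is_lattice (S : set 'rV[R]_d) B0 :
  subgroup S -> B0 \in unitmx -> (forall i, S (row i B0)) ->
  finite_set [set x | S x /\ lat_floor B0 x = 0] -> is_lattice S.
Proof.
move=> subS B0u SB0 Pfin.
set P := [set x | _] in Pfin; pose F := fset_set P.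
pose N := (#|` F|).+1`!.
have mulN x : S x -> exists z, x *+ N = lat B0 z.
  move=> Sx.
  pose f (k : 'I_(#|` F|).+1) : 'rV[R]_d :=
    x *+ k - lat B0 (lat_floor B0 (x *+ k)).
  have fP k : f k \in F.
    rewrite in_fset_set // inE; split; last exact: lat_floor_sub.
    apply: subS.2; last exact: lat_rows.
    by rewrite pmulrn; exact: subgroupMz.
  have : ~ injective f.
    move=> finj; pose g k : F := [` fP k]%fset.
    have /leq_card : injective g by move=> k l /(congr1 val) /finj.
    by rewrite card_ord -cardfE ltnn.
  have Dk (k l : 'I_(#|` F|).+1) : (k < l)%N -> f k = f l ->
      exists z, x *+ N = lat B0 z.
    move=> kl fkl.
    have [q ->] : exists q, N = ((l - k) * q)%N.
      have /dvdnP [q Nq] : (l - k %| N)%N.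
        apply: dvdn_fact; rewrite subn_gt0 kl /=.
        by apply: leq_trans (leq_subr _ _) _; apply: ltnW.
      by exists q; rewrite Nq mulnC.
    have -> : x *+ ((l - k) * q) =
        lat B0 (lat_floor B0 (x *+ l) - lat_floor B0 (x *+ k)) *+ q.
      rewrite mulrnA latB mulrnBr; last exact: ltnW.
      congr (_ *+ q); move: fkl; rewrite /f => /eqP.
      rewrite subr_eq addrAC eq_sym subr_eq => /eqP h.
      by apply/eqP; rewrite subr_eq addrAC eq_sym subr_eq addrC -h addrC.
    move: (_ - _) => w; exists (w *+ q).
    by elim: q => [|q IH]; rewrite ?mulr0n ?lat0 // !mulrS latD IH.
  move=> /injectiveP /injectivePn [k [l kl fkl]].
  by case: (ltngtP k l) => [/Dk|/Dk|/val_inj klE]; [exact|exact|rewrite klE eqxx in kl].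
have N0 : N%:R != 0 :> R by rewrite pnatr_eq0 -lt0n fact_gt0.
have SZ x z : lat B0 z = x *+ N -> N%:R^-1 *: lat B0 z = x.
  by move=> ->; rewrite -(scaler_nat N x) scalerA mulVf // scale1r.
pose A := [set z | S (N%:R^-1 *: lat B0 z)].
have subA : subgroup A.
  split; first by rewrite /A /= lat0 scaler0; exact: subS.1.
  by move=> z w Az Aw; rewrite /A /= latB scalerBr; exact: subS.2.
have [|Z Z0 AE] := integer_sublattice_basis subA.
  exists (N%:R)%:M; first by rewrite det_scalar expf_neq0 // pnatr_eq0 -lt0n fact_gt0.
  move=> i; rewrite /A /=; set y := (X in S X); suff -> : y = row i B0 by [].
  apply: SZ; rewrite /lat map_row map_scalar_mx -row_mul mul_scalar_mx.
  by rewrite rmorph_nat linearZ /= scaler_nat.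
pose B := N%:R^-1 *: (map_mx intr Z *m B0).
have latE z : lat B z = N%:R^-1 *: lat B0 (z *m Z).
  by rewrite /lat /B -scalemxAr mulmxA map_mxM.
exists B.
  rewrite unitmxE detZ det_mulmx det_map_mx unitfE !mulf_neq0 //.
  - by rewrite expf_neq0 // invr_eq0.
  - by rewrite intr_eq0.
  - by rewrite -unitfE -unitmxE.
apply/seteqP; split => [x Sx|_ [z _ <-]].
  have [z xz] := mulN x Sx.
  have : A z by rewrite /A /= (SZ x).
  by rewrite AE => -[w _ wz]; exists w => //; rewrite -/(lat B w) latE wz; exact: SZ.
by rewrite -/(lat B z) latE; change (A (z *m Z)); rewrite AE; exists z.
Qed.

End RealLattice.

(** * Barycentric coordinates *)

Section AffineIndependence.
Context {R : realType} {d : nat}.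
Implicit Types s : {fset 'rV[R]_d}.

Definition vertices_mx n s : 'M[R]_(n, d) := \matrix_(i < n) nth 0 s i.

(** Affine independence of the vertices v is linear independence of the rows
(1, v). *)
Definition homogeneous_mx n s : 'M[R]_(n, 1 + d) :=
  row_mx (const_mx 1) (vertices_mx n s).

Lemma sum_fset_nth (V : nmodType) s n (F : 'rV[R]_d -> V) : #|` s| = n ->
  \sum_(v <- s) F v = \sum_(i < n) F (nth 0 s i).
Proof. by move=> <-; rewrite (big_nth 0) big_mkord. Qed.

Lemma mem_fset_nth s n (i : 'I_n) : #|` s| = n -> nth 0 s i \in s.
Proof. by move=> sn; apply: mem_nth; rewrite sn. Qed.

Lemma index_fset_lt s n v : #|` s| = n -> v \in s -> (index v s < n)%N.
Proof. by move=> <- vs; rewrite index_mem. Qed.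

Lemma homogeneous_mx_free s n :
  aff_indep s -> #|` s| = n -> row_free (homogeneous_mx n s).
Proof.
move=> indep sn; apply: inj_row_free => v.
rewrite mul_mx_row -row_mx0 => /eq_row_mx [v1 v2].
pose c w : R := \sum_(i < n | nth 0 s i == w) v 0 i.
have cE (i : 'I_n) : c (nth 0 s i) = v 0 i.
  rewrite /c (big_pred1 i) // => j.
  by rewrite /= nth_uniq ?fset_uniq // -?topredE /= sn.
have c0 : forall w, w \in s -> c w = 0.
  apply: indep; rewrite (sum_fset_nth _ sn).
    have := congr1 (fun w : 'M[R]_1 => w 0 0) v1; rewrite /= mxE [RHS]mxE => v1'.
    by rewrite -[RHS]v1'; apply: eq_bigr => i _; rewrite cE mxE mulr1.
  rewrite -[RHS]v2 mulmx_sum_row; apply: eq_bigr => i _.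
  by rewrite cE rowK.
by apply/rowP => i; rewrite [RHS]mxE -cE c0 // (mem_fset_nth _ sn).
Qed.

Lemma aff_indep_card s : aff_indep s -> (#|` s| <= d.+1)%N.
Proof.
by move=> /homogeneous_mx_free /(_ erefl) /eqP <-; exact: rank_leq_col.
Qed.

(** The barycentric coordinate of x at w is dot x (nu w) + ca w.  The clauses say
that the matrix of these affine functions is the inverse, on both sides, of the
matrix of the rows (1, v).  The vector nu w is normal to the wall opposite to w. *)
Definition barycentric s (nu : 'rV[R]_d -> 'rV[R]_d) (ca : 'rV[R]_d -> R) :=
  [/\ forall v w, v \in s -> w \in s -> dot v (nu w) + ca w = (v == w)%:R,
      \sum_(w <- s) nu w = 0,
      \sum_(w <- s) ca w = 1,
      \sum_(w <- s) ca w *: w = 0 &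
      forall y, \sum_(w <- s) dot y (nu w) *: w = y].

(** The functionals are the columns of the inverse of the square matrix with rows
(1, v). *)
Lemma barycentric_functionals s : aff_indep s -> #|` s| = d.+1 ->
  exists nu ca, barycentric s nu ca.
Proof.
move=> indep sd.
have Au : homogeneous_mx (1 + d) s \in unitmx.
  by rewrite -row_free_unit; apply: homogeneous_mx_free.
set A := homogeneous_mx _ _ in Au.
pose C : 'rV[R]_(1 + d) := usubmx (invmx A).
pose N : 'M[R]_(d, 1 + d) := dsubmx (invmx A).
pose ix w : 'I_(1 + d) := inord (index w s).
have ixE w : w \in s -> ix w = index w s :> nat.
  by move=> ws; rewrite inordK // (index_fset_lt sd).
have nix (i : 'I_(1 + d)) : ix (nth 0 s i) = i.
  apply: val_inj; rewrite /= ixE ?(mem_fset_nth _ sd) //.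
  by rewrite index_uniq ?fset_uniq // sd.
exists (fun w => (col (ix w) N)^T), (fun w => C 0 (ix w)).
have AC : const_mx 1 *m C + vertices_mx (1 + d) s *m N = 1%:M.
  by rewrite -mul_row_col vsubmxK mulmxV.
have [CA NA] : C *m A = row_mx 1%:M 0 /\ N *m A = row_mx 0 1%:M.
  apply/eq_col_mx; rewrite -mul_col_mx vsubmxK mulVmx // scalar_mx_block.
  by [].
move: CA NA; rewrite /A /homogeneous_mx !mul_mx_row.
move=> /eq_row_mx [C1 CV] /eq_row_mx [N1 NV].
have dotN y w : dot y (col (ix w) N)^T = (y *m N) 0 (ix w).
  by rewrite dotE trmxK mxE [RHS]mxE; apply: eq_bigr => i _; rewrite mxE.
split.
- move=> v w vs ws; have := congr1 (fun M : 'M[R]_(1 + d) => M (ix v) (ix w)) AC.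
  rewrite mxE mxE big_ord1 mxE mul1r addrC => AC'.
  rewrite dotN.
  have -> : (v *m N) 0 (ix w) = (vertices_mx (1 + d) s *m N) (ix v) (ix w).
    transitivity (row (ix v) (vertices_mx (1 + d) s *m N) 0 (ix w)).
      by rewrite row_mul rowK ixE // nth_index.
    by rewrite mxE.
  rewrite AC' mxE; congr (nat_of_bool _)%:R; apply/eqP/eqP => [|-> //].
  move/(congr1 val); rewrite /= !ixE // => /(congr1 (nth 0 s)).
  by rewrite !nth_index.
- rewrite (sum_fset_nth _ sd); apply/rowP => k; rewrite summxE mxE.
  have := congr1 (fun M : 'cV[R]_d => M k 0) N1; rewrite /= mxE [RHS]mxE => N1'.
  by rewrite -[RHS]N1'; apply: eq_bigr => i _; rewrite nix !mxE mulr1.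
- rewrite (sum_fset_nth _ sd).
  have := congr1 (fun M : 'M[R]_1 => M 0 0) C1; rewrite /= mxE [RHS]mxE => C1'.
  by rewrite -[RHS]C1'; apply: eq_bigr => i _; rewrite nix !mxE mulr1.
- rewrite (sum_fset_nth _ sd) -[RHS]CV mulmx_sum_row.
  by apply: eq_bigr => i _; rewrite nix rowK.
- move=> y; rewrite (sum_fset_nth _ sd) -[RHS]mulmx1 -NV mulmxA mulmx_sum_row.
  by apply: eq_bigr => i _; rewrite dotN nix rowK.
Qed.

Lemma barycentric_span s nu ca y : barycentric s nu ca ->
  (forall w, w \in s -> dot y (nu w) = 0) -> y = 0.
Proof.
move=> [_ _ _ _ bE] y0; rewrite -[y]bE big1_seq // => w /andP [_ ws].
by rewrite y0 // scale0r.
Qed.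

(** With at most d rows (1, v) in dimension d + 1, some nonzero vector is orthogonal
to all of them. *)
Lemma simplex_in_hyperplane s : s != fset0 -> (#|` s| <= d)%N ->
  exists2 n : 'rV[R]_d, n != 0 & exists c, forall v, v \in s -> dot v n = c.
Proof.
move=> /fset0Pn [v0 v0s] sd.
have : kermx (homogeneous_mx #|` s| s)^T != 0.
  rewrite -mxrank_eq0 mxrank_ker mxrank_tr subn_eq0 -ltnNge ltnS.
  by apply: leq_trans (rank_leq_row _) sd.
case/rowV0Pn => y /sub_kermxP; rewrite -[y]hsubmxK => yA y0.
have h v : v \in s -> dot v (rsubmx y) = - lsubmx y 0 0.
  move=> vs; have iv := index_fset_lt erefl vs.
  have := congr1 (fun M : 'rV[R]_#|` s| => M 0 (Ordinal iv)) yA.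
  rewrite tr_row_mx mul_row_col mxE [RHS]mxE => /eqP.
  rewrite addrC addr_eq0 [X in _ == - X]mxE big_ord1 ![X in _ == - (_ * X)]mxE mulr1.
  move=> /eqP <-; rewrite [RHS]mxE.
  by rewrite dotC /dot; apply: eq_bigr => i _; rewrite !mxE nth_index.
exists (rsubmx y); last by exists (- lsubmx y 0 0).
(* If the linear part vanished, a vertex v0 would force the constant to vanish. *)
apply/eqP => r0; case/eqP: y0; rewrite r0.
suff -> : lsubmx y = 0 by rewrite row_mx0.
apply/rowP => i; rewrite ord1 [RHS]mxE; apply/eqP; rewrite -oppr_eq0.
by rewrite -(h v0) // r0 dot0r.
Qed.

End AffineIndependence.

(** * Hyperplanes and closed simplices *)

Section Topology.
Context {R : realType} {d : nat}.
Implicit Types (x n : 'rV[R]_d) (s : {fset 'rV[R]_d}).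

Lemma continuous_add (U : topologicalType) (f g : U -> R) :
  continuous f -> continuous g -> continuous (fun t => f t + g t).
Proof. by move=> hf hg x; apply: cvgD; [exact: hf|exact: hg]. Qed.

Lemma continuous_mul (U : topologicalType) (f g : U -> R) :
  continuous f -> continuous g -> continuous (fun t => f t * g t).
Proof. by move=> hf hg x; apply: cvgM; [exact: hf|exact: hg]. Qed.

Lemma dot_continuous n : continuous (fun x => dot x n).
Proof.
rewrite /dot; elim: (index_enum _) => [|i r IH].
  under eq_fun do rewrite big_nil; exact: cst_continuous.
under eq_fun do rewrite big_cons.
apply: continuous_add IH.
apply: (@continuous_mul 'rV[R]_d (fun v => v 0 i) (fun=> n 0 i)).
  exact: coord_continuous.
exact: cst_continuous.
Qed.

(** The moment curve x + (t, t^2, ..., t^d) meets each hyperplane for finitely many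
t only, because the equation is a nonzero polynomial in t; so some point of the
curve close to x avoids finitely many hyperplanes. *)
Lemma avoid_hyperplanes (hs : seq ('rV[R]_d * R)) x (U : set 'rV[R]_d) :
  nbhs x U -> (forall h, h \in hs -> h.1 != 0) ->
  exists2 y, U y & forall h, h \in hs -> dot y h.1 != h.2.
Proof.
move=> /nbhs_ballP [e /= e0 xeU] hs0.
pose gam t : 'rV[R]_d := x + \row_j t ^+ j.+1.
pose P (h : 'rV[R]_d * R) : {poly R} :=
  (dot x h.1 - h.2)%:P + \sum_(j < d) h.1 0 j *: 'X^(j.+1).
have PE h t : (P h).[t] = dot (gam t) h.1 - h.2.
  rewrite hornerD hornerC horner_sum dotDl [RHS]addrAC; congr (_ + _).
  by apply: eq_bigr => j _; rewrite hornerZ hornerXn mxE mulrC.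
have P0 h : h.1 != 0 -> P h != 0.
  apply: contra => /eqP Ph; apply/eqP/rowP => i; rewrite mxE.
  have := congr1 (fun p : {poly R} => p`_i.+1) Ph.
  rewrite coef0 coefD coefC /= add0r coef_sum (bigD1 i) //= big1 => [|j ji].
    by rewrite coefZ coefXn eqxx mulr1 addr0.
  by rewrite coefZ coefXn eqSS eq_sym val_eqE (negPf ji) mulr0.
pose Q := \prod_(h <- hs) P h.
have Q0 : Q != 0 by rewrite prodf_seq_neq0; apply/allP => h /hs0 /P0.
pose m := Num.min e 1.
have m0 : 0 < m by rewrite lt_min e0 ltr01.
pose tt (k : nat) : R := m / (k.+2)%:R.
have tt_inj : injective tt.
  move=> k l /(mulfI (lt0r_neq0 m0)) /invr_inj /eqP.
  by rewrite eqr_nat => /eqP [].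
have : ~~ all (root Q) (map tt (iota 0 (size Q))).
  apply/negP => /(max_poly_roots Q0).
  by rewrite map_inj_uniq ?iota_uniq // size_map size_iota ltnn => /(_ isT).
case/allPn => _ /mapP [k _ ->] Qt; exists (gam (tt k)).
  apply: xeU; split => // i j; rewrite ord1 /ball /= !mxE opprD addrA subrr add0r normrN.
  have t0 : 0 < tt k by rewrite divr_gt0.
  have tm : tt k < m.
    by rewrite ltr_pdivrMr ?ltr0n // ltr_pMr // ltr1n.
  rewrite ger0_norm ?exprn_ge0 ?ltW //.
  apply: (@le_lt_trans _ _ (tt k)); last by rewrite (lt_le_trans tm) // ge_min lexx.
  rewrite exprS ler_piMr ?exprn_ile1 ?ltW //.
  by rewrite (lt_le_trans tm) // ge_min lexx orbT.
move=> h hhs; apply/eqP => gh; case/negP: Qt; rewrite /root horner_prod.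
by rewrite prodf_seq_eq0; apply/hasP; exists h => //=; rewrite PE gh subrr.
Qed.

(** A simplex with d + 1 vertices is the intersection of the half spaces where its
barycentric coordinates are nonnegative. *)
Lemma top_hull_closed s : aff_indep s -> #|` s| = d.+1 -> closed (hull s).
Proof.
move=> indep sd.
have [nu [ca [b1 b2 b3 b4 b5]]] := barycentric_functionals indep sd.
have -> : hull s = \bigcap_(w in [set` s]) [set x | 0 <= dot x (nu w) + ca w].
  apply/seteqP; split => [x [c [c0 c1 ->]] w /= ws|x h].
    suff -> : dot (\sum_(v <- s) c v *: v) (nu w) + ca w = c w by exact: c0.
    rewrite dot_suml -[ca w]mul1r -c1 mulr_suml -big_split /=.
    rewrite (big_fsetD1 w) //= dotZl -mulrDr b1 // eqxx mulr1.
    rewrite big1_fset ?addr0 // => v; rewrite !inE => /andP [vw vs] _.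
    by rewrite dotZl -mulrDr b1 // (negPf vw) mulr0.
  exists (fun w => dot x (nu w) + ca w); split; first exact: h.
  - rewrite big_split /= b3.
    have -> : \sum_(i <- s) dot x (nu i) = dot x (\sum_(i <- s) nu i).
      by rewrite dotC dot_suml; apply: eq_bigr => i _; rewrite dotC.
    by rewrite b2 dot0r add0r.
  - by under eq_bigr do rewrite scalerDl; rewrite big_split /= b4 b5 addr0.
apply: closed_bigI => w ws.
apply: (@preimage_closed _ _ (fun x => dot x (nu w) + ca w) [set t | 0 <= t]).
  move=> x _; apply: continuous_add x; first exact: dot_continuous.
  exact: cst_continuous.
exact: closed_ge.
Qed.

End Topology.

(** * Chambers and connectedness of the skeleton *)

Section TriangulationTheory.
Context {R : realType} {d : nat}.
Variable T : triangulation R d.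
Implicit Types (x v : 'rV[R]_d) (s t : {fset 'rV[R]_d}).

Lemma mem_hull s v : v \in s -> hull s v.
Proof.
move=> vs; exists (fun w => (w == v)%:R); split=> [w _||].
- exact: ler0n.
- rewrite (big_fsetD1 v) //= eqxx big1_fset ?addr0 // => w.
  by rewrite !inE => /andP [/negPf -> _] _.
- rewrite (big_fsetD1 v) //= eqxx scale1r big1_fset ?addr0 // => w.
  by rewrite !inE => /andP [/negPf -> _] _; rewrite scale0r.
Qed.

Lemma hull_neq0 s x : hull s x -> exists v, v \in s.
Proof.
move=> [c [_ c1 _]]; apply/fset0Pn/eqP => s0.
by move: c1; rewrite s0 big_nil => /eqP; rewrite eq_sym oner_eq0.
Qed.

Lemma hull_share_vertex s t x : T s -> T t -> hull s x -> hull t x ->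
  exists2 v, v \in s & v \in t.
Proof.
move=> Ts Tt sx tx.
have : (hull s `&` hull t) x by [].
rewrite (tri_meet Ts Tt) => /hull_neq0 [v]; rewrite inE => /andP [].
by exists v.
Qed.

Lemma hull_vertex s v : T s -> T [fset v]%fset -> hull s v -> v \in s.
Proof.
move=> Ts Tv sv; have vv : hull [fset v]%fset v by apply: mem_hull; rewrite inE.
by have [w ws] := hull_share_vertex Ts Tv sv vv; rewrite inE => /eqP <-.
Qed.

Lemma vertexT s v : T s -> v \in s -> T [fset v]%fset.
Proof.
move=> Ts vs; apply: (tri_face Ts); first by rewrite fsub1set.
by apply/fset0Pn; exists v; rewrite inE.
Qed.

Lemma star_finite v : finite_set [set s | T s /\ v \in s].
Proof.
have [U vU Ufin] := tri_locfin T v; apply: sub_finite_set Ufin => s [Ts vs].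
by split => //; exists v; split; [exact: mem_hull|exact: nbhs_singleton].
Qed.

(** A locally finite union of closed sets is closed. *)
Lemma tops_closed (C : set {fset 'rV[R]_d}) :
  closed [set x | exists s, [/\ top_simplex T s, C s & hull s x]].
Proof.
set A := [set x | _].
suff : open (~` A) by rewrite openC.
rewrite openE => x Ax; have [U xU Ufin] := tri_locfin T x.
pose F := [set s | (T s /\ hull s `&` U !=set0) /\ (top_simplex T s /\ C s)].
have Fcl : closed (\bigcup_(s in F) hull s).
  apply: closed_bigcup => [|s [_ [[Ts sd] _]]].
    by apply: sub_finite_set Ufin => s [].
  exact: top_hull_closed (tri_indep Ts) sd.
have : nbhs x (~` (\bigcup_(s in F) hull s)).
  apply: open_nbhs_nbhs; split; first by rewrite openC.
  by move=> [s [_ [tops Cs]] sx]; apply: Ax; exists s.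
move=> xF; apply: filterS (filterI xU xF) => y [Uy yF] [s [tops Cs sy]].
apply: yF; exists s => //; split => //; split; first exact: tops.1.
by exists y.
Qed.

(** The union of the chambers is closed.  Around a point outside it, finitely many
simplices of lower dimension would cover a neighbourhood, but they lie in finitely
many hyperplanes. *)
Lemma tops_cover x : exists2 s, top_simplex T s & hull s x.
Proof.
have Acl : closed _ := @tops_closed setT; move: Acl; set A := [set x | _] => Acl.
apply: contrapT => noTop.
have Ax : nbhs x (~` A).
  apply: open_nbhs_nbhs; split; first by rewrite openC.
  by move=> [s [tops _ sx]]; apply: noTop; exists s.
have [U xU /finite_seqP [ss ssE]] := tri_locfin T x.
have /choice [h hP] : forall s, exists h : 'rV[R]_d * R,
    T s -> (#|` s| <= d)%N ->
    h.1 != 0 /\ forall v, v \in s -> dot v h.1 = h.2.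
  move=> s; have [[Ts sd]|nh] := pselect (T s /\ (#|` s| <= d)%N).
    by have [n n0 [c nc]] := simplex_in_hyperplane (tri_neq0 Ts) sd; exists (n, c).
  by exists (0, 0) => Ts sd; case: nh.
have ssP s : s \in ss -> T s by move=> sin; have : [set` ss] s by []; rewrite -ssE => -[].
pose ss' : seq {fset 'rV[R]_d} := [seq s <- ss | (#|` s| <= d)%N].
have [g|y [Uy Ay] yh] := avoid_hyperplanes (hs := map h ss') (filterI xU Ax).
  by case/mapP => s; rewrite mem_filter => /andP [sd /ssP Ts] ->; exact: (hP s Ts sd).1.
have [s Ts sy] := tri_cover T y.
have sin : s \in ss by have : [set` ss] s by rewrite -ssE; split => //; exists y.
have [sd|sd] := leqP #|` s| d; last first.
  apply: Ay; exists s; split => //; split => //; apply/eqP.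
  by rewrite eqn_leq sd (aff_indep_card (tri_indep Ts)).
have ins : s \in ss' by rewrite mem_filter sd.
have /eqP := yh (h s) (map_f h ins).
case: (hP s Ts sd) => _ hs; apply; case: sy => c [_ c1 ->].
rewrite dot_suml -[RHS]mul1r -c1 mulr_suml.
by apply: eq_big_seq => v vs; rewrite dotZl hs.
Qed.

Lemma vertex_in_top v : T [fset v]%fset -> exists2 s, top_simplex T s & v \in s.
Proof.
by move=> Tv; have [s tops sv] := tops_cover v; exists s => //; exact: hull_vertex tops.1 Tv sv.
Qed.

Definition skel_reach (x y : vert (skeleton T)) := clos_refl_trans _ (@adjacent (skeleton T)) x y.

Lemma skel_adjacent (x y : vert (skeleton T)) s : T s -> sval x \in s -> sval y \in s ->
  x <> y -> @adjacent (skeleton T) x y.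
Proof.
case: x y => [x Tx] [y Ty] /= Ts xs ys xy.
have xy' : x != y.
  by apply/eqP => xE; apply: xy; move: Tx; rewrite xE => Tx; congr exist; exact: Prop_irrelevance.
have Txy : T [fset x; y]%fset.
  apply: (tri_face Ts); first by rewrite fsubUset !fsub1set xs.
  by apply/fset0Pn; exists x; rewrite !inE eqxx.
exists (exist (fun xy => xy.1 != xy.2 /\ T [fset xy.1; xy.2]%fset) (x, y) (conj xy' Txy)).
by split; apply: eq_exist.
Qed.

Lemma skel_reach_simplex (x y : vert (skeleton T)) s : T s -> sval x \in s -> sval y \in s ->
  skel_reach x y.
Proof.
move=> Ts xs ys; have [->|xy] := pselect (x = y); first exact: rt_refl.
by apply: rt_step; exact: (skel_adjacent Ts xs ys xy).
Qed.

(** Let A be the union of the chambers with a vertex reachable from x and B the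
union of the other chambers.  Both are closed, they cover the space, and they are
disjoint, because chambers that meet share a vertex; hence A contains the segment
from x to any other vertex. *)
Lemma skeleton_connected : connected_graph (skeleton T).
Proof.
split.
  have [s [Ts _] /hull_neq0 [v vs]] := tops_cover 0.
  by constructor; exists v; exact: vertexT Ts vs.
move=> x y.
pose reached s := exists2 v : vert (skeleton T), skel_reach x v & sval v \in s.
have reachedV s (v : vert (skeleton T)) : T s -> reached s -> sval v \in s -> skel_reach x v.
  move=> Ts [w xw ws] vs; by apply: (rt_trans _ _ _ _ _ xw); exact: (skel_reach_simplex Ts).
pose A := [set z | exists s, [/\ top_simplex T s, reached s & hull s z]].
pose B := [set z | exists s, [/\ top_simplex T s, ~ reached s & hull s z]].
have Acl : closed A := @tops_closed reached.
have Bcl : closed B := @tops_closed (fun s => ~ reached s).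
have AB z : A z -> ~ B z.
  move=> [s [[Ts _] rs sz]] [t [[Tt _] rt tz]]; apply: rt.
  have [v vs vt] := hull_share_vertex Ts Tt sz tz.
  pose v' : vert (skeleton T) := exist _ v (vertexT Ts vs).
  by exists v' => //; exact: (reachedV s v').
have AorB z : A z \/ B z.
  have [s tops sz] := tops_cover z.
  by have [rs|rs] := pselect (reached s); [left|right]; exists s.
pose seg (t : R) : 'rV[R]_d := sval x + t *: (sval y - sval x).
have segc : continuous seg.
  move=> t; apply: (@cvgD R 'rV[R]_d); first exact: cvg_cst.
  exact: scalel_continuous.
have conn : connected (seg @` `[0, 1]).
  apply: connected_continuous_connected; first exact: segment_connected.
  exact: continuous_subspaceT.
have Ax : A (sval x).
  have [s tops xs] := vertex_in_top (svalP x).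
  by exists s; split => //; [exists x => //; exact: rt_refl|exact: mem_hull].
have in01 (t : R) : t = 0 \/ t = 1 -> `[0, 1]%classic t.
  by case=> ->; rewrite /= in_itv /= lexx ler01.
have segA : (seg @` `[0, 1]) `&` A = seg @` `[0, 1].
  apply: conn.
  - exists (sval x); split => //; exists 0; first by apply: in01; left.
    by rewrite /seg scale0r addr0.
  - exists (~` B); first by rewrite openC.
    apply/seteqP; split => z [sz]; first by move=> /AB.
    by move=> nB; split => //; case: (AorB z).
  - by exists A.
have : A (sval y).
  have : (seg @` `[0, 1]) (sval y).
    exists 1; first by apply: in01; right.
    by rewrite /seg scale1r addrC subrK.
  by rewrite -segA => -[].
move=> [s [[Ts _] rs sy]]; apply: (reachedV s y) => //.
exact: hull_vertex Ts (svalP y) sy.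
Qed.

Lemma bounded_simplices_finite (M : R) :
  finite_set [set s | T s /\ exists2 x, hull s x & forall i, `|x 0 i| <= M].
Proof.
pose K := [set x : 'rV[R]_d | forall i, `[- M, M]%classic (x 0 i)].
have Kc : compact K 
  by apply: (@rV_compact _ _ (fun=> `[- M, M]%classic)) => _; exact: segment_compact.
have /choice [U UP] : forall x, exists U,
    nbhs x U /\ finite_set [set s | T s /\ hull s `&` U !=set0].
  by move=> x; have [U xU Ufin] := tri_locfin T x; exists U.
move: Kc; rewrite compact_cover => /(_ _ setT (fun x => interior (U x))) [].
- by move=> x _; exact: open_interior.
- by move=> x _; exists x => //; exact: (UP x).1.
move=> D _ KD.
apply: (@sub_finite_set _ _ (\bigcup_(x in [set` D]) [set s | T s /\ hull s `&` U x !=set0])).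
  move=> s [Ts [x sx xM]].
  have : K x by move=> i; rewrite /= in_itv /= -ler_norml.
  move=> /KD [y yD Uy]; exists y => //; split => //; exists x; split => //.
  exact: interior_subset Uy.
by apply: bigcup_finite => [|x _]; [exact: finite_fset|exact: (UP x).2].
Qed.

End TriangulationTheory.

(** * The group of a Coxeter complex and its translations *)

Lemma finite_families (V : choiceType) (A : set V) m : finite_set A ->
  finite_set [set f : 'I_m -> V | forall i, A (f i)].
Proof.
move=> /finite_fsetP [X AX].
apply: (@sub_finite_set _ _ ((fun (F : {ffun 'I_m -> X}) i => val (F i)) @` setT)).
  move=> f fA; have fX i : f i \in X by have := fA i; rewrite AX.
  exists [ffun i => [` fX i]%fset] => //; apply/funext => i.
  by rewrite /= ffunE.
exact/finite_image/finite_finset.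
Qed.

Section AffineMaps.
Context {R : realType} {d : nat}.
Implicit Types (x y a n : 'rV[R]_d) (g h : 'rV[R]_d -> 'rV[R]_d).

(** For affine g this is the matrix of the linear part, acting on the right of row
vectors. *)
Definition linear_part g : 'M[R]_d := \matrix_i (g (delta_mx 0 i) - g 0).

Definition affine_isometry g := 
  (forall x, g x = x *m linear_part g + g 0) /\
  linear_part g *m (linear_part g)^T = 1%:M.

Lemma linear_partE g (W : 'M[R]_d) a : (forall x, g x = x *m W + a) -> linear_part g = W.
Proof.
move=> gE; apply/row_matrixP => i.
by rewrite rowK !gE mul0mx add0r addrK -rowE.
Qed.

Lemma affine_isometryP g (W : 'M[R]_d) a : W *m W^T = 1%:M ->
  (forall x, g x = x *m W + a) -> affine_isometry g.
Proof.
move=> WW gE; split; rewrite (linear_partE gE) // => x.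
by rewrite [g 0]gE mul0mx add0r gE.
Qed.

Lemma isometry_sub g x y : affine_isometry g -> g x - g y = (x - y) *m linear_part g.
Proof.
by case=> gE _; rewrite (gE x) (gE y) opprD addrACA subrr addr0 mulmxBl.
Qed.

Lemma isometry_sum g (I : Type) (r : seq I) (c : I -> R) (F : I -> 'rV[R]_d) :
  affine_isometry g -> \sum_(i <- r) c i = 1 ->
  g (\sum_(i <- r) c i *: F i) = \sum_(i <- r) c i *: g (F i).
Proof.
case=> gE _ c1; rewrite gE -[g 0]scale1r -c1 mulmx_suml scaler_suml -big_split /=.
by apply: eq_bigr => i _; rewrite [in RHS]gE scalerDr -scalemxAl.
Qed.

Definition lin_reflection n x := x - (2 * dot x n / dot n n) *: n.

Lemma reflection_fix a n x : dot (x - a) n = 0 -> reflection a n x = x.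
Proof. by move=> h; rewrite /reflection h mulr0 mul0r scale0r subr0. Qed.

Lemma lin_reflection_mx n x :
  lin_reflection n x = x *m (1%:M - (2 / dot n n) *: (n^T *m n)).
Proof.
rewrite mulmxBr mulmx1 -scalemxAr mulmxA /lin_reflection; congr (_ - _).
rewrite [x *m n^T]mx11_scalar -dotE mul_scalar_mx scalerA; congr (_ *: _).
by rewrite mulrAC.
Qed.

Lemma reflectionE a n x : reflection a n x = lin_reflection n (x - a) + a.
Proof. by rewrite /reflection /lin_reflection addrAC subrK. Qed.

Lemma reflection_sub a n x y :
  reflection a n x - reflection a n y = lin_reflection n (x - y).
Proof.
rewrite !reflectionE !lin_reflection_mx opprD addrACA subrr addr0 -mulmxBl.
by congr (_ *m _); rewrite opprB addrA subrK.
Qed.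

Lemma reflection_isometry a n : affine_isometry (reflection a n).
Proof.
set W := 1%:M - (2 / dot n n) *: (n^T *m n).
apply: (@affine_isometryP _ W (a - a *m W)); last first.
  by move=> x; rewrite reflectionE lin_reflection_mx mulmxBl addrAC addrA.
have -> : W^T = W by rewrite /W linearB /= linearZ /= trmx1 trmx_mul trmxK.
have [n0|n0] := eqVneq n 0.
  by rewrite /W n0 mulmx0 scaler0 subr0 mulmx1.
apply/row_matrixP => i; rewrite !rowE mulmxA -!lin_reflection_mx mulmx1.
set x := delta_mx 0 i; have nn : dot n n != 0 by rewrite dot_eq0.
rewrite /lin_reflection dotBl dotZl -addrA -opprD -scalerDl.
rewrite [X in X *: n](_ : _ = 0) ?scale0r ?subr0 //.
by field.
Qed.

Lemma linear_part_reflection a n x :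
  x *m linear_part (reflection a n) = lin_reflection n x.
Proof.
have := isometry_sub x 0 (reflection_isometry a n).
by rewrite reflection_sub subr0 => ->.
Qed.

End AffineMaps.

Section CoxeterGroup.
Context {R : realType} {d : nat}.
Variable T : triangulation R d.
Hypothesis T_coxeter : coxeter_complex T.
Implicit Types (x y a n v w : 'rV[R]_d) (g h : 'rV[R]_d -> 'rV[R]_d).
Implicit Types s t : {fset 'rV[R]_d}.

Lemma Gamma_isometry g : Gamma T g -> affine_isometry g.
Proof.
elim=> {g} [|g [[n n0 [a ->]] _]|g h _ [gE gg] _ [hE hh]|g h _ [gE gg] gh hg].
- by apply: (@affine_isometryP _ _ _ 1%:M 0) => [|x]; rewrite ?trmx1 mulmx1 ?addr0.
- exact: reflection_isometry.
- apply: (@affine_isometryP _ _ _ (linear_part h *m linear_part g) (g (h 0))).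
    by rewrite trmx_mul mulmxA -[_ *m _ *m (linear_part g)^T]mulmxA gg mulmx1.
  by move=> x /=; rewrite (hE x) gE [g (h 0)]gE mulmxDl mulmxA addrA.
- have gg' : (linear_part g)^T *m linear_part g = 1%:M by exact: mulmx1C.
  apply: (@affine_isometryP _ _ _ (linear_part g)^T (- g 0 *m (linear_part g)^T)).
    by rewrite trmxK.
  by move=> x; rewrite -[in RHS](hg x) gE -mulmxDl addrK -mulmxA gg mulmx1.
Qed.

Lemma Gamma_inverse g : Gamma T g -> exists h, [/\ Gamma T h, cancel g h & cancel h g].
Proof.
move=> Gg; have [gE gg] := Gamma_isometry Gg.
have gg' : (linear_part g)^T *m linear_part g = 1%:M by exact: mulmx1C.
pose h x := (x - g 0) *m (linear_part g)^T.
have gh : cancel g h by move=> x; rewrite /h gE addrK -mulmxA gg mulmx1.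
have hg : cancel h g by move=> x; rewrite gE /h -mulmxA gg' mulmx1 subrK.
by exists h; split => //; exact: (Gen_inv Gg gh hg).
Qed.

Lemma hull_image g s x : Gamma T g -> hull s x -> hull (act_simplex g s) (g x).
Proof.
move=> Gg [c [c0 c1 ->]]; have [h [Gh gh hg]] := Gamma_inverse Gg.
have ginj := can_inj gh.
exists (c \o h); split.
- by move=> v /imfsetP [w /= ws ->]; rewrite gh; exact: c0.
- rewrite /act_simplex big_imfset /=; last by move=> ? ? _ _; exact: ginj.
  by rewrite -[RHS]c1; apply: eq_bigr => v _; rewrite gh.
- rewrite (isometry_sum _ (Gamma_isometry Gg)) // /act_simplex big_imfset /=.
    by apply: eq_bigr => v _; rewrite gh.
  by move=> ? ? _ _; exact: ginj.
Qed.

Lemma top_orbit_cover s x : top_simplex T s ->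
  exists2 g, Gamma T g & exists2 y, hull s y & g y = x.
Proof.
move=> tops; have [t topt tx] := tops_cover T x.
have [g Gg gst] := T_coxeter.2 _ _ tops topt.
have [h [Gh gh hg]] := Gamma_inverse Gg.
exists g => //; exists (h x); last exact: hg.
have -> : s = act_simplex h t.
  rewrite -gst /act_simplex -imfset_comp; apply/fsetP => v; apply/idP/imfsetP => /=.
    by move=> vs; exists v => //=; rewrite gh.
  by move=> [w ws ->]; rewrite /= gh.
exact: hull_image.
Qed.

Lemma conjugate_reflection g a n : Gamma T g -> Gamma T (reflection a n) ->
  Gamma T (reflection (g a) (n *m linear_part g)).
Proof.
move=> Gg Gr; have [h [Gh gh hg]] := Gamma_inverse Gg.
have Ig := Gamma_isometry Gg.
suff -> : reflection (g a) (n *m linear_part g) = g \o (reflection a n \o h).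
  by apply: Gen_comp => //; apply: Gen_comp.
apply/funext => x /=; rewrite -{1}[x]hg; move: (h x) => {}x.
rewrite /reflection isometry_sub // !dot_orthogonal; try exact: Ig.2.
by rewrite [in RHS]Ig.1 mulmxBl -scalemxAl addrAC -Ig.1.
Qed.


Lemma barycentricP s : top_simplex T s -> exists nu ca, barycentric s nu ca.
Proof. by move=> [/tri_indep indep sd]; exact: barycentric_functionals. Qed.

(** This reflection fixes the facet opposite to w, so it is one of the generators. *)
Lemma wall_reflection s nu ca w : top_simplex T s -> barycentric s nu ca ->
  w \in s -> nu w != 0 ->
  exists a, Gamma T (reflection a (nu w)) /\
    forall v, v \in s -> v != w -> reflection a (nu w) v = v.
Proof.
move=> tops [b1 _ _ _ _] ws nuw; set n := nu w.
(* A point of the wall: the foot of the perpendicular from the origin to the wall. *)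
exists (- (ca w / dot n n) *: n).
have fixes v : v \in s -> v != w -> reflection (- (ca w / dot n n) *: n) n v = v.
  move=> vs vw; apply: reflection_fix.
  rewrite dotBl dotZl mulNr opprK divfK ?dot_eq0 //.
  by rewrite b1 // (negPf vw).
split=> //; apply: Gen_in; split; first by exists n => //; exists (- (ca w / dot n n) *: n).
exists s, (s `\ w)%fset; split => //; first exact: fsubD1set.
  by move: tops.2; rewrite (cardfsD1 w) ws => -[].
by move=> v; rewrite !inE => /andP [vw vs]; exact: fixes.
Qed.

(** The unit normals of the mirrors. *)
Definition roots : set 'rV[R]_d :=
  [set n | dot n n = 1 /\ exists a, Gamma T (reflection a n)].

Lemma roots_linear_part n g : roots n -> Gamma T g -> roots (n *m linear_part g).
Proof.
move=> [n1 [a Gr]] Gg; split; first by rewrite dot_orthogonal //; exact: (Gamma_isometry Gg).2.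
by exists (g a); exact: conjugate_reflection.
Qed.

Lemma scale_reflection a n k : k != 0 -> reflection a (k *: n) = reflection a n.
Proof.
move=> k0; apply/funext => x; rewrite /reflection !dotZr !dotZl scalerA; congr (_ - _ *: _).
have [->|n0] := eqVneq n 0; first by rewrite !dot0r !(mulr0, mul0r).
by field; rewrite k0 dot_eq0 n0.
Qed.

Lemma roots_span y : (forall n, roots n -> dot n y = 0) -> y = 0.
Proof.
move=> y0; have [s tops _] := tops_cover T 0.
have [nu [ca bary]] := barycentricP tops.
apply: (barycentric_span bary) => w ws.
have [->|nuw] := eqVneq (nu w) 0; first exact: dot0r.
have [a [Ga _]] := wall_reflection tops bary ws nuw.
have l0 : 0 < Num.sqrt (dot (nu w) (nu w)) by rewrite sqrtr_gt0 dot_gt0.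
have /y0 : roots ((Num.sqrt (dot (nu w) (nu w)))^-1 *: nu w).
  split; last first.
    by exists a; rewrite scale_reflection // invr_eq0 gt_eqF.
  rewrite dotZl dotZr mulrA -expr2 exprVn sqr_sqrtr ?dot_ge0 // mulVf //.
  by rewrite dot_eq0.
move/eqP; rewrite dotZl mulf_eq0 invr_eq0 gt_eqF //= => /eqP <-.
exact: dotC.
Qed.

Definition star_vertices s : set 'rV[R]_d :=
  [set z | exists t, [/\ T t, exists2 v, v \in s & v \in t & z \in t]].

Lemma star_vertices_finite s : finite_set (star_vertices s).
Proof.
apply: (@sub_finite_set _ _ (\bigcup_(v in [set` s])
   \bigcup_(t in [set t | T t /\ v \in t]) [set` t])).
  by move=> z [t [Tt [v vs vt] zt]]; exists v => //; exists t.
apply: bigcup_finite => [|v _]; first exact: finite_fset.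
by apply: bigcup_finite => [|t _]; [exact: star_finite|exact: finite_fset].
Qed.

(** A finite set that contains the unit normals of all mirrors meeting s. *)
Definition local_directions s : set 'rV[R]_d :=
  [set n | exists v z (b : bool), [/\ v \in s, star_vertices s z &
     n = (-1) ^+ b *: ((Num.sqrt (dot (z - v) (z - v)))^-1 *: (z - v))]].

Lemma local_directions_finite s : finite_set (local_directions s).
Proof.
apply: (@sub_finite_set _ _ (\bigcup_(v in [set` s]) \bigcup_(z in star_vertices s)
   \bigcup_(b in [set: bool])
  [set (-1) ^+ b *: ((Num.sqrt (dot (z - v) (z - v)))^-1 *: (z - v))])).
  by move=> n [v [z [b [vs zs ->]]]]; exists v => //; exists z => //; exists b.
apply: bigcup_finite => [|v _]; first exact: finite_fset.
apply: bigcup_finite => [|z _]; first exact: star_vertices_finite.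
by apply: bigcup_finite => [|b _]; [exact: finite_finset|exact: finite_set1].
Qed.

(** Some vertex v of s is off the mirror, since s spans the space.  Its image z is a
vertex of the image of s, a simplex that shares the fixed point x with s, and z - v
is a multiple of n. *)
Lemma local_root s n a x : top_simplex T s -> dot n n = 1 ->
  Gamma T (reflection a n) -> hull s x -> dot (x - a) n = 0 ->
  local_directions s n.
Proof.
move=> tops n1 Gr sx xa; set r := reflection a n in Gr.
have [nu [ca bary]] := barycentricP tops.
have [v vs va] : exists2 v, v \in s & dot (v - a) n != 0.
  apply: contrapT => /forall2NP nov.
  have vn v : v \in s -> dot v n = dot a n.
    move=> vs; apply/eqP; rewrite -subr_eq0 -dotBl.
    by case: (nov v) => // /negP; rewrite negbK.
  have [_ nu0 _ _ bE] := bary.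
  have : dot n n = 0.
    rewrite -{1}[n]bE dot_suml.
    rewrite (eq_big_seq (fun w => dot (nu w) (dot a n *: n))); last first.
      by move=> w ws; rewrite dotZl vn // dotZr mulrC (dotC n).
    by rewrite -dot_suml nu0 dot0l.
  by rewrite n1 => /eqP; rewrite oner_eq0.
pose z := r v; have Tt := T_coxeter.1 _ _ Gr tops.1.
have tx : hull (act_simplex r s) x.
  by rewrite -(reflection_fix xa); exact: hull_image.
have zz : star_vertices s z.
  exists (act_simplex r s); split => //.
    by have [w ws wt] := hull_share_vertex tops.1 Tt sx tx; exists w.
  by apply/imfsetP; exists v.
set b := dot (v - a) n in va.
have zv : z - v = (- (2 * b)) *: n.
  by rewrite /z /r /reflection n1 divr1 addrAC subrr add0r scaleNr.
have b2 : 2 * b != 0 by rewrite mulf_neq0 // pnatr_eq0.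
exists v, z, (0 < b); split => //.
rewrite zv dotZl dotZr n1 mulr1 -expr2 sqrtr_sqr normrN scalerA.
rewrite -[LHS]scale1r scalerA; congr (_ *: _).
case: (ltgtP 0 b) => [b0|b0|b0]; last by rewrite -b0 eqxx in va.
  by rewrite gtr0_norm ?mulr_gt0 // expr1 mulN1r mulrNN mulVf.
by rewrite ltr0_norm ?pmulr_rlt0 // expr0 mul1r mulVf ?oppr_eq0.
Qed.

Definition root_products s : set R :=
  [set c | c = 1 \/ c = -1 \/
    exists m m', [/\ local_directions s m, local_directions s m' & c = dot m m']].

Lemma root_products_finite s : finite_set (root_products s).
Proof.
apply: (@sub_finite_set _ _ ([set 1] `|` ([set -1] `|`
   \bigcup_(m in local_directions s) \bigcup_(m' in local_directions s)
   [set dot m m']))).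
  move=> c [->|[->|[m [m' [hm hm' ->]]]]]; [by left|by right; left|].
  by right; right; exists m => //; exists m'.
rewrite !finite_setU; split; first exact: finite_set1.
split; first exact: finite_set1.
apply: bigcup_finite => [|m _]; first exact: local_directions_finite.
apply: bigcup_finite => [|m' _]; first exact: local_directions_finite.
exact: finite_set1.
Qed.

(** If the mirrors are not parallel they have a common point x, and some h in the
group maps x into s.  Conjugation by h preserves the inner product of the normals and
gives two mirrors meeting s. *)
Lemma dot_roots s n n' : top_simplex T s -> roots n -> roots n' ->
  root_products s (dot n n').
Proof.
move=> tops [n1 [a Gr]] [n1' [a' Gr']]; set c := dot n n'.
have [/eqP|c2] := eqVneq (c ^+ 2) 1.
  by rewrite sqrf_eq1 => /orP [] /eqP ->; [left|right; left].
right; right.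
have c20 : 1 - c ^+ 2 != 0 by rewrite subr_eq0 eq_sym.
(* The point of the second mirror on the line through a, in the first mirror, in
   the direction of the projection of n' on the first mirror. *)
pose t := dot (a' - a) n' / (1 - c ^+ 2); pose x := a + t *: (n' - c *: n).
have xa : dot (x - a) n = 0.
  by rewrite /x addrAC subrr add0r dotZl dotBl dotZl n1 (dotC n') mulr1 subrr mulr0.
have xa' : dot (x - a') n' = 0.
  rewrite /x addrAC dotDl dotZl [dot (n' - _) _]dotBl dotZl n1' -/c -expr2.
  by rewrite /t divfK // -dotDl addrA subrK subrr dot0l.
have [g Gg [y sy gy]] := top_orbit_cover x tops.
have [h [Gh gh hg]] := Gamma_inverse Gg.
have Ih := Gamma_isometry Gh.
exists (n *m linear_part h), (n' *m linear_part h); split.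
- apply: (@local_root s _ (h a) y) => //.
  + by rewrite dot_orthogonal //; exact: Ih.2.
  + exact: conjugate_reflection.
  + by rewrite -[y]gh gy isometry_sub // dot_orthogonal //; exact: Ih.2.
- apply: (@local_root s _ (h a') y) => //.
  + by rewrite dot_orthogonal //; exact: Ih.2.
  + exact: conjugate_reflection.
  + by rewrite -[y]gh gy isometry_sub // dot_orthogonal //; exact: Ih.2.
- by rewrite dot_orthogonal //; exact: Ih.2.
Qed.

(** A vector is determined by its products with a basis of roots. *)
Lemma roots_finite : finite_set roots.
Proof.
have [s tops _] := tops_cover T 0.
have [M Mu MR] := basis_of_spanning roots_span.
apply: (@sub_finite_set _ _ ((fun f : 'I_d -> R => (\row_i f i) *m invmx M^T) @`
   [set f | forall i, root_products s (f i)])); last first.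
  exact/finite_image/finite_families/root_products_finite.
move=> n Rn; exists (fun i => dot n (row i M)).
  by move=> i; exact: dot_roots.
have -> : \row_i dot n (row i M) = n *m M^T.
  apply/rowP => i; rewrite !mxE; apply: eq_bigr => j _.
  by rewrite !mxE.
by rewrite mulmxK // unitmx_tr.
Qed.

(** A linear part is determined by its values on a basis of roots, which are roots. *)
Lemma linear_parts_finite : finite_set [set linear_part g | g in Gamma T].
Proof.
have [M Mu MR] := basis_of_spanning roots_span.
apply: (@sub_finite_set _ _ ((fun f : 'I_d -> 'rV[R]_d => invmx M *m \matrix_i f i) @`
   [set f | forall i, roots (f i)])); last first.
  exact/finite_image/finite_families/roots_finite.
move=> _ [g Gg <-]; exists (fun i => row i M *m linear_part g).
  by move=> i; exact: roots_linear_part.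
have -> : \matrix_i (row i M *m linear_part g) = M *m linear_part g.
  by apply/row_matrixP => i; rewrite rowK row_mul.
by rewrite mulKmx.
Qed.

Definition translation_lattice : set 'rV[R]_d :=
  [set l | Gamma T (fun x => x + l)].

Lemma translation_subgroup : subgroup translation_lattice.
Proof.
split.
  rewrite /translation_lattice /=; suff -> : (fun x => x + 0) = @id 'rV[R]_d by exact: Gen_id.
  by apply/funext => x; rewrite addr0.
move=> l l' Gl Gl'; rewrite /translation_lattice /=.
have -> : (fun x => x + (l - l')) = (fun x => x + l) \o (fun x => x - l').
  by apply/funext => x /=; rewrite addrAC addrA.
apply: Gen_comp => //; apply: (Gen_inv Gl') => x; first by rewrite addrK.
by rewrite subrK.
Qed.

Lemma same_linear_part g h : Gamma T g -> Gamma T h ->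
  linear_part g = linear_part h -> translation_lattice (g 0 - h 0).
Proof.
move=> Gg Gh gh; have [k [Gk hk kh]] := Gamma_inverse Gh.
rewrite /translation_lattice /=.
suff -> : (fun x => x + (g 0 - h 0)) = g \o k by apply: Gen_comp.
apply/funext => x /=; rewrite -{1}[x]kh.
rewrite (Gamma_isometry Gh).1 [RHS](Gamma_isometry Gg).1 gh.
by rewrite -addrA [h 0 + _]addrC subrK.
Qed.

(** Modulo translations the group is finite, so a linear form that vanishes on the
translations takes finitely many values on the images of the vertices of a chamber
s.  As the images of s cover the space, the form is bounded, hence 0. *)
Lemma translation_span y :
  (forall l, translation_lattice l -> dot l y = 0) -> y = 0.
Proof.
move=> y0; have [s tops _] := tops_cover T 0.
have /choice [gW gWP] : forall W : 'M[R]_d, exists g : 'rV[R]_d -> 'rV[R]_d,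
    [set linear_part g | g in Gamma T] W -> Gamma T g /\ linear_part g = W.
  move=> W; have [[g Gg <-]|nW] := pselect ([set linear_part g | g in Gamma T] W).
    by exists g.
  by exists id => /nW.
pose D : set R := \bigcup_(W in [set linear_part g | g in Gamma T])
   \bigcup_(v in [set` s]) [set dot (gW W v) y].
have Dfin : finite_set D.
  apply: bigcup_finite => [|W _]; first exact: linear_parts_finite.
  by apply: bigcup_finite => [|v _]; [exact: finite_fset|exact: finite_set1].
have [C DC] : exists C, forall b, D b -> b <= C.
  have /finite_seqP [r DE] := Dfin.
  exists (\sum_(b <- r) `|b|) => b; rewrite DE /= => br.
  rewrite (big_rem b) //=; apply: le_trans (ler_norm b) _.
  by rewrite lerDl sumr_ge0.
have gD g v : Gamma T g -> v \in s -> dot (g v) y <= C.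
  move=> Gg vs; have lg : [set linear_part g | g in Gamma T] (linear_part g) by exists g.
  have [Gw gwE] := gWP _ lg.
  apply: DC; exists (linear_part g) => //; exists v => //=.
  rewrite (Gamma_isometry Gg).1 (Gamma_isometry Gw).1 gwE.
  apply/eqP; rewrite -subr_eq0 -dotBl opprD addrACA subrr add0r; apply/eqP.
  by apply: y0; exact: same_linear_part.
have bound z : dot z y <= C.
  have [g Gg [u [c [c0 c1 ->]] <-]] := top_orbit_cover z tops.
  rewrite (isometry_sum _ (Gamma_isometry Gg)) // dot_suml -[C]mul1r -c1 mulr_suml.
  rewrite !big_seq; apply: ler_sum => v vs.
  by rewrite dotZl ler_wpM2l ?c0 // gD.
apply/eqP; rewrite -dot_eq0; apply/negPn/negP => yy.
have := bound (((C + 1) / dot y y) *: y).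
by rewrite dotZl divfK // gerDl ler10.
Qed.

(** The group is discrete because it moves a vertex v to vertices, and finitely many
of them are bounded by a given constant. *)
Lemma translation_is_lattice : is_lattice translation_lattice.
Proof.
have [B Bu BL] := basis_of_spanning translation_span.
apply: (discrete_subgroup_is_lattice translation_subgroup Bu BL).
have [s tops /hull_neq0 [v vs]] := tops_cover T 0.
pose M := \sum_i \sum_j `|B i j| + \sum_i `|v 0 i|.
apply: (@sub_finite_set _ _ (\bigcup_(t in [set t | T t /\ exists2 x, hull t x &
   forall i, `|x 0 i| <= M]) [set w - v | w in [set` t]])); last first.
  apply: bigcup_finite => [|t _]; first exact: bounded_simplices_finite.
  exact/finite_image/finite_fset.
move=> l [Ll l0]; exists [fset (v + l)%R]%fset; last first.
  exists (v + l); first by rewrite /= inE.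
  by rewrite addrAC subrr add0r.
split.
  have := T_coxeter.1 _ _ Ll (vertexT tops.1 vs).
  by rewrite /act_simplex imfset_fset1.
exists (v + l); first by apply: mem_hull; rewrite inE.
move=> i; rewrite mxE; apply: le_trans (ler_normD _ _) _.
rewrite addrC lerD //; last first.
  by rewrite (bigD1 i) //= lerDl sumr_ge0.
exact: (fund_domain_bounded i Bu l0).
Qed.

Lemma translation_linear_part g l : Gamma T g -> translation_lattice l ->
  translation_lattice (l *m linear_part g).
Proof.
move=> Gg Gl; have [h [Gh gh hg]] := Gamma_inverse Gg.
rewrite /translation_lattice /=.
suff -> : (fun x => x + l *m linear_part g) = g \o ((fun x => x + l) \o h).
  by apply: Gen_comp => //; apply: Gen_comp.
apply/funext => x /=; rewrite -{1}[x]hg.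
by rewrite [g (h x)](Gamma_isometry Gg).1 [g (h x + l)](Gamma_isometry Gg).1 mulmxDl addrAC.
Qed.

End CoxeterGroup.

(** * The quotient of the skeleton by a lattice *)

Lemma gmor_ext (X Y : graph) (f g : gmor X Y) : mv f =1 mv g -> me f =1 me g -> f = g.
Proof.
case: f g => [f1 f2 fo ft fi] [g1 g2 go gt gi] /= /funext h1 /funext h2.
move: fo ft fi go gt gi; rewrite h1 h2 => fo ft fi go gt gi.
by congr GMor; exact: Prop_irrelevance.
Qed.

Lemma clos_refl_trans_invariant (V : Type) (r : V -> V -> Prop) (P : V -> Prop) x0 y0 :
  (forall x1 y1, r x1 y1 -> P x1 -> P y1) -> clos_refl_trans _ r x0 y0 -> P x0 -> P y0.
Proof. by move=> rP; elim=> [x1 y1 /rP||x1 y1 z1 _ h1 _ h2 /h1 /h2]. Qed.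

Section QuotientGraph.
Context {R : realType} {d : nat}.
Variables (T : triangulation R d) (B : 'M[R]_d).
Hypothesis Bu : B \in unitmx.
Hypothesis shiftT : forall z s, T s -> T (act_simplex (fun x => x + lat B z) s).
Implicit Types (x y : 'rV[R]_d) (z : 'rV[int]_d) (e : 'rV[R]_d * 'rV[R]_d).

Local Notation X := (skeleton T).
Local Notation lat := (lat B).
Local Notation fl := (lat_floor B).

Lemma shiftT1 z x : T [fset x]%fset -> T [fset (x + lat z)%R]%fset.
Proof. by move=> /(shiftT z); rewrite /act_simplex imfset_fset1. Qed.

Lemma shiftT2 z x y : T [fset x; y]%fset -> T [fset (x + lat z)%R; (y + lat z)%R]%fset.
Proof. by move=> /(shiftT z); rewrite /act_simplex imfset_fset2. Qed.

Definition is_edge e := e.1 != e.2 /\ T [fset e.1; e.2]%fset.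

Definition shift_pair z e := (e.1 + lat z, e.2 + lat z).

Lemma is_edge_shift z e : is_edge e -> is_edge (shift_pair z e).
Proof.
by move=> [ne Te]; split; [rewrite /= (inj_eq (addIr _))|exact: shiftT2].
Qed.

Lemma is_edge_swap e : is_edge e -> is_edge (e.2, e.1).
Proof. by move=> [ne Te]; split; rewrite /= 1?eq_sym 1?fsetUC. Qed.

Definition shift_vert z (x : vert X) : vert X := exist _ (sval x + lat z) (shiftT1 z (svalP x)).

Definition shift_edge z (e : edge X) : edge X :=
  exist _ (shift_pair z (sval e)) (is_edge_shift z (svalP e)).

Lemma shift_org z (e : edge X) : org (shift_edge z e) = shift_vert z (org e).
Proof. exact: eq_exist. Qed.

Lemma shift_ter z (e : edge X) : ter (shift_edge z e) = shift_vert z (ter e).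
Proof. exact: eq_exist. Qed.

Lemma shift_inv z (e : edge X) : inv (shift_edge z e) = shift_edge z (inv e).
Proof. exact: eq_exist. Qed.

Definition shift z : gmor X X := GMor (shift_org z) (shift_ter z) (shift_inv z).

Lemma shift_is_translation z : is_translation (lat z) (shift z).
Proof. by []. Qed.

Lemma skel_edge_eq (e e' : edge X) : org e = org e' -> ter e = ter e' -> e = e'.
Proof.
move=> /(congr1 (@sval _ _)) /= o /(congr1 (@sval _ _)) /= t.
by case: e e' o t => [[x y] h] [[x' y'] h'] /= o t; apply: eq_exist; rewrite o t.
Qed.

Lemma skel_gmor_ext (f g : gmor X X) : mv f =1 mv g -> f = g.
Proof.
move=> fg; apply: gmor_ext => // u.
by apply: skel_edge_eq; rewrite ?mor_org ?mor_ter fg.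
Qed.

Lemma translation_shift z f : is_translation (lat z) f -> f = shift z.
Proof.
move=> fz; apply: skel_gmor_ext => u; have := fz u.
by rewrite /inclusion; case: (mv f u) => y h /= E; apply: eq_exist.
Qed.

Lemma shiftD z (z' : 'rV[int]_d) : shift (z + z') = gcomp (shift z) (shift z').
Proof.
by apply: skel_gmor_ext => u; apply: eq_exist; rewrite /= latD addrA addrAC.
Qed.

Lemma shift_automorphism z : automorphism (shift z).
Proof.
have K z' (u : vert X) : mv (shift (- z')) (mv (shift z') u) = u.
  by case: u => x h; apply: eq_exist; rewrite /= latN addrK.
have KE z' (f : edge X) : me (shift (- z')) (me (shift z') f) = f.
  by apply: skel_edge_eq; rewrite ?mor_org ?mor_ter K.
have := K (- z); have := KE (- z); rewrite opprK => KE' K'.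
by split; [exists (mv (shift (- z)))|exists (me (shift (- z)))].
Qed.

Definition red x := x - lat (fl x).

(** The pair translated so that its first point is in the fundamental domain. *)
Definition red_pair e := (red e.1, e.2 - lat (fl e.1)).

Lemma red_shift x z : red (x + lat z) = red x.
Proof. by rewrite /red (lat_floorD _ _ Bu) latD opprD addrACA subrr addr0. Qed.

Lemma fl_red x : fl (red x) = 0.
Proof. exact: lat_floor_sub. Qed.

Lemma red_id x : fl x = 0 -> red x = x.
Proof. by move=> x0; rewrite /red x0 lat0 subr0. Qed.

Lemma red_pair_shift z e : red_pair (shift_pair z e) = red_pair e.
Proof.
rewrite /red_pair /= red_shift; congr pair.
by rewrite (lat_floorD _ _ Bu) latD opprD addrACA subrr addr0.
Qed.

Lemma red_pairE e : red_pair e = shift_pair (- fl e.1) e.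
Proof. by rewrite /red_pair /shift_pair latN. Qed.

Lemma red_pair_id e : fl e.1 = 0 -> red_pair e = e.
Proof. by case: e => x y /= x0; rewrite /red_pair /= red_id // x0 lat0 subr0. Qed.

Lemma is_edge_red e : is_edge e -> is_edge (red_pair e).
Proof. by rewrite red_pairE; exact: is_edge_shift. Qed.

Lemma red_pair_swap e : red_pair ((red_pair e).2, (red_pair e).1) = red_pair (e.2, e.1).
Proof. by rewrite [red_pair e]red_pairE /=; exact: (red_pair_shift _ (e.2, e.1)). Qed.

Definition fund_verts := [set x | T [fset x]%fset /\ fl x = 0].
Definition fund_edges := [set e | is_edge e /\ fl e.1 = 0].

Lemma fund_verts_finite : finite_set fund_verts.
Proof.
pose M := \sum_i \sum_j `|B i j|.
apply: (@sub_finite_set _ _ (\bigcup_(t in [set t | T t /\ exists2 x, hull t x &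
   forall i, `|x 0 i| <= M]) [set` t])); last first.
  apply: bigcup_finite => [|t _]; first exact: bounded_simplices_finite.
  exact: finite_fset.
move=> x [Tx x0]; exists [fset x]%fset; last by rewrite /= inE.
split=> //; exists x; first by apply: mem_hull; rewrite inE.
by move=> i; exact: (fund_domain_bounded i Bu x0).
Qed.

Lemma fund_edges_finite : finite_set fund_edges.
Proof.
apply: (@sub_finite_set _ _ (\bigcup_(x in fund_verts)
   \bigcup_(t in [set t | T t /\ x \in t]) [set (x, y) | y in [set` t]])).
  move=> [x y] [[/= xy Txy] x0]; exists x.
    by split => //; apply: (vertexT Txy); rewrite !inE eqxx.
  by exists [fset x; y]%fset; [split|exists y] => //=; rewrite !inE eqxx ?orbT.
apply: bigcup_finite => [|x _]; first exact: fund_verts_finite.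
apply: bigcup_finite => [|t _]; first exact: star_finite.
exact/finite_image/finite_fset.
Qed.

Definition qvert : {fset 'rV[R]_d} := fset_set fund_verts.
Definition qedge : {fset 'rV[R]_d * 'rV[R]_d} := fset_set fund_edges.

Lemma qvertP x : x \in qvert <-> fund_verts x.
Proof. by rewrite in_fset_set ?inE //; exact: fund_verts_finite. Qed.

Lemma qedgeP e : e \in qedge <-> fund_edges e.
Proof. by rewrite in_fset_set ?inE //; exact: fund_edges_finite. Qed.

Lemma red_qvert x : T [fset x]%fset -> red x \in qvert.
Proof.
by move=> Tx; apply/qvertP; split; [rewrite /red -latN; exact: shiftT1|exact: fl_red].
Qed.

Lemma red_qedge e : is_edge e -> red_pair e \in qedge.
Proof. by move=> /is_edge_red he; apply/qedgeP; split=> //; exact: fl_red. Qed.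

Lemma edge_org e : is_edge e -> T [fset e.1]%fset.
Proof. by move=> [_ Te]; apply: (vertexT Te); rewrite !inE eqxx. Qed.

Lemma edge_ter e : is_edge e -> T [fset e.2]%fset.
Proof. by move=> [_ Te]; apply: (vertexT Te); rewrite !inE eqxx orbT. Qed.

Lemma qedge_edge (e : qedge) : is_edge (val e).
Proof. by have /qedgeP [] := valP e. Qed.

Lemma qedge_fl (e : qedge) : fl (val e).1 = 0.
Proof. by have /qedgeP [] := valP e. Qed.

(** An edge of the quotient is represented by its lift that starts in the
fundamental domain, and a vertex by its lift in the fundamental domain. *)
Definition qorg (e : qedge) : qvert := [` red_qvert (edge_org (qedge_edge e))]%fset.
Definition qter (e : qedge) : qvert := [` red_qvert (edge_ter (qedge_edge e))]%fset.
Definition qinv (e : qedge) : qedge :=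
  [` red_qedge (is_edge_swap (qedge_edge e))]%fset.

Lemma qinv_inv (e : qedge) : qinv (qinv e) = e.
Proof.
apply: val_inj; rewrite /= (red_pair_swap ((val e).2, (val e).1)) /=.
by rewrite -surjective_pairing red_pair_id // qedge_fl.
Qed.

Lemma qorg_inv (e : qedge) : qorg (qinv e) = qter e.
Proof. by apply: val_inj; rewrite /= red_id // fl_red. Qed.

(** If a translation exchanged the ends x and y of an edge, its double would fix x,
so it would be 0. *)
Lemma qinv_neq (e : qedge) : qinv e <> e.
Proof.
move=> qe; have E : red_pair ((val e).2, (val e).1) = val e := congr1 val qe.
move: (qedge_fl e) (qedge_edge e) E; case: (val e) => x y /= x0 [/= xy _] E.
have yx : red y = x := congr1 fst E.
have xy' : x - lat (fl y) = y := congr1 snd E.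
have z0 : fl y = 0.
  have yl : y = x + lat (fl y) by rewrite -yx /red subrK.
  have xl : x = y + lat (fl y) by rewrite -{1}xy' subrK.
  have : lat (fl y + fl y) = lat 0.
    by apply: (addrI x); rewrite latD addrA -yl -xl lat0 addr0.
  move=> /(lat_inj Bu) /rowP ll; apply/rowP => i; have := ll i; rewrite !mxE.
  by lia.
by move: xy; rewrite -yx /red z0 lat0 subr0 eqxx.
Qed.

Definition quotient_graph : fgraph := FGraph qinv_inv qorg_inv qinv_neq.

Definition qproj_vert (u : vert X) : vert quotient_graph :=
  [` red_qvert (svalP u)]%fset.

Definition qproj_edge (f : edge X) : edge quotient_graph :=
  [` @red_qedge (sval f) (svalP f)]%fset.

Lemma qproj_org f : org (qproj_edge f) = qproj_vert (org f).
Proof. by apply: val_inj; rewrite /= red_id // fl_red. Qed.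

Lemma qproj_ter f : ter (qproj_edge f) = qproj_vert (ter f).
Proof. by apply: val_inj; rewrite /= -latN red_shift. Qed.

Lemma qproj_inv f : inv (qproj_edge f) = qproj_edge (inv f).
Proof. by apply: val_inj; rewrite /= red_pair_swap. Qed.

Definition qproj : gmor X quotient_graph := GMor qproj_org qproj_ter qproj_inv.

Lemma qproj_vert_shift z u : qproj_vert (shift_vert z u) = qproj_vert u.
Proof. by apply: val_inj; rewrite /= red_shift. Qed.

Lemma qproj_edge_shift z f : qproj_edge (shift_edge z f) = qproj_edge f.
Proof. by apply: val_inj; exact: red_pair_shift. Qed.

Lemma qproj_vert_eq u u' : qproj_vert u = qproj_vert u' -> exists z, shift_vert z u = u'.
Proof.
move=> /(congr1 val) /= rr; exists (fl (sval u') - fl (sval u)).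
case: u u' rr => [x h] [x' h'] /= rr; apply: eq_exist.
by rewrite latB addrCA addrC -/(red x) rr /red subrK.
Qed.

Lemma qproj_edge_eq f f' : qproj_edge f = qproj_edge f' -> exists z, shift_edge z f = f'.
Proof.
move=> /(congr1 val) /= rr; exists (fl (sval f').1 - fl (sval f).1).
case: f f' rr => [[x y] h] [[x' y'] h'] /= [rx ry]; apply: eq_exist.
rewrite /shift_pair /= latB; congr pair.
  by rewrite addrCA addrC -/(red x) rx /red subrK.
by rewrite addrCA addrC ry subrK.
Qed.

Lemma qproj_vert_surj (q : vert quotient_graph) : exists u, qproj_vert u = q.
Proof.
have /qvertP [Tq q0] := valP q; exists (exist _ (val q) Tq).
by apply: val_inj; rewrite /= red_id.
Qed.

Lemma qproj_edge_surj (q : edge quotient_graph) : exists f, qproj_edge f = q.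
Proof.
exists (exist _ (val q) (qedge_edge q)); apply: val_inj.
by rewrite /= red_pair_id // qedge_fl.
Qed.

Definition lattice : set 'rV[R]_d := [set lat z | z in [set: 'rV[int]_d]].

Lemma translations_shift f : translations T lattice f <-> exists z, shift z = f.
Proof.
split=> [[_ [z _ <-]] /translation_shift ->|[z <-]]; first by exists z.
by exists (lat z) => //; exists z.
Qed.

Lemma qproj_quotient : quotient_map (translations T lattice) qproj.
Proof.
split; [exact: qproj_vert_surj|exact: qproj_edge_surj|..].
- move=> u u'; split=> [/qproj_vert_eq [z <-]|[f /translations_shift [z <-] <-]].
    by exists (shift z) => //; apply/translations_shift; exists z.
  by rewrite /= qproj_vert_shift.
- move=> f f'; split=> [/qproj_edge_eq [z <-]|[g /translations_shift [z <-] <-]].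
    by exists (shift z) => //; apply/translations_shift; exists z.
  by rewrite /= qproj_edge_shift.
Qed.

Lemma qproj_covering : covering_map qproj.
Proof.
split; first exact: qproj_vert_surj.
move=> u e' e'u; have [f fe'] := qproj_edge_surj e'.
have [z zu] : exists z, shift_vert z (org f) = u.
  by apply: qproj_vert_eq; rewrite -qproj_org fe'.
exists (shift_edge z f); split.
  by rewrite -zu shift_org /= qproj_edge_shift.
move=> g [gu ge']; have [w wg] : exists w, shift_edge w f = g.
  by apply: qproj_edge_eq; rewrite fe'.
suff -> : z = w by [].
apply: (lat_inj Bu); apply: (addrI (sval (org f))).
move: gu; rewrite -zu -wg => /(congr1 (@sval _ _)) /=.
by [].
Qed.

Lemma shift_deck z : deck qproj (shift z).
Proof.
split; [exact: shift_automorphism|exact: qproj_vert_shift|exact: qproj_edge_shift].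
Qed.

(** A deck transformation moves both ends of an edge by the same lattice vector,
hence all vertices of the connected skeleton. *)
Lemma deck_translations : deck qproj = translations T lattice.
Proof.
apply/seteqP; split=> [f [_ fv fe]|f /translations_shift [z <-]]; last exact: shift_deck.
have [[u0] conn] := skeleton_connected T.
have [z zu0] : exists z, shift_vert z u0 = mv f u0.
  by apply: qproj_vert_eq; have := fv u0.
apply/translations_shift; exists z; apply: skel_gmor_ext => u.
apply: (clos_refl_trans_invariant (P := fun u => mv (shift z) u = mv f u) _ (conn u0 u)) => //.
move=> _ _ [g [<- <-]] zg.
have [w wg] : exists w, shift_edge w g = me f g.
  by apply: qproj_edge_eq; have := fe g.
suff zw : z = w by rewrite -!mor_ter zw -wg.
apply: (lat_inj Bu); apply: (addrI (sval (org g))).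
move: zg; rewrite -[in RHS]mor_org -wg shift_org.
by move/(congr1 (@sval _ _)).
Qed.

Lemma quotient_graph_connected : connected_graph quotient_graph.
Proof.
have [[u0] conn] := skeleton_connected T.
split; first by constructor; exact: (qproj_vert u0).
move=> q q'; have [u <-] := qproj_vert_surj q; have [u' <-] := qproj_vert_surj q'.
apply: (clos_refl_trans_invariant (P := fun v =>
  clos_refl_trans _ (@adjacent quotient_graph) (qproj_vert u) (qproj_vert v)) _ (conn u u')).
  move=> _ _ [g [<- <-]] h; apply: rt_trans h _; apply: rt_step.
  by exists (qproj_edge g); rewrite qproj_org qproj_ter.
exact: rt_refl.
Qed.

Lemma qproj_crystal : topological_crystal d qproj.
Proof.
split.
- exact: quotient_graph_connected.
- exact: skeleton_connected.
- exact: qproj_covering.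
- move=> u u' /qproj_vert_eq [z <-]; exists (shift z) => //; exact: shift_deck.
- exists shift; split; [|apply/seteqP; split|exact: shiftD].
  + move=> z w zw; apply: (lat_inj Bu).
    have [[u0] _] := skeleton_connected T; apply: (addrI (sval u0)).
    by have := congr1 (fun f : gmor X X => sval (mv f u0)) zw.
  + by move=> _ [z _ <-]; exact: shift_deck.
  + by move=> f; rewrite deck_translations => /translations_shift [z <-]; exists z.
Qed.

Lemma lattice_preserves : translations_preserve T lattice.
Proof.
move=> _ [z _ <-]; exists (shift z); [exact: shift_automorphism|exact: shift_is_translation].
Qed.

End QuotientGraph.

(** * Chains and cycles *)

Section Integration.
Variables (X0 : fgraph) (A : comPzRingType) (V : lmodType A).
Implicit Types (c : {ffun fedge X0 -> A}) (phi : fedge X0 -> V).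

(** This selects one edge of each pair {e, finv e}. *)
Definition oriented (e : fedge X0) := (enum_rank e < enum_rank (finv e))%N.

Lemma oriented_inv e : oriented (finv e) = ~~ oriented e.
Proof.
rewrite /oriented finv_inv -leqNgt [RHS]leq_eqVlt.
by case: eqP => // /ord_inj /enum_rank_inj /finv_neq.
Qed.

Lemma sum_oriented (W : nmodType) (F : fedge X0 -> W) :
  \sum_e F e = \sum_(e | oriented e) (F e + F (finv e)).
Proof.
rewrite (bigID oriented) /= big_split; congr (_ + _).
rewrite (reindex_inj (can_inj (@finv_inv X0))) /=.
by apply: eq_bigl => e; rewrite oriented_inv negbK.
Qed.

Definition integral c phi : V := \sum_(e | oriented e) c e *: phi e.

Lemma integralDl c c' phi : integral (c + c') phi = integral c phi + integral c' phi.
Proof. by rewrite /integral -big_split; apply: eq_bigr => e _; rewrite ffunE scalerDl. Qed.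

Lemma integralNl c phi : integral (- c) phi = - integral c phi.
Proof. by rewrite /integral -sumrN; apply: eq_bigr => e _; rewrite ffunE scaleNr. Qed.

Lemma integral0l phi : integral 0 phi = 0.
Proof. by rewrite /integral big1 // => e _; rewrite ffunE scale0r. Qed.

Lemma integral_chain1 e phi : (forall f, phi (finv f) = - phi f) ->
  integral (chain1 A e) phi = phi e.
Proof.
move=> phi_odd; have sumE f : \sum_(e' | oriented e') (e' == f)%:R *: phi e' =
    if oriented f then phi f else 0.
  case: ifP => hf.
    rewrite (bigD1 f) //= eqxx scale1r big1 ?addr0 // => g /andP [_ /negPf ->].
    by rewrite scale0r.
  rewrite big1 // => g og; case: eqP => [gf|_]; last by rewrite scale0r.
  by rewrite -gf og in hf.
rewrite /integral; under eq_bigr do rewrite ffunE scalerBl.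
rewrite sumrB !sumE oriented_inv phi_odd.
by case: (oriented e); rewrite ?subr0 // sub0r opprK.
Qed.

(** The discrete Stokes formula. *)
Lemma integral_gradient c (s : fvert X0 -> V) : is_chain c ->
  integral c (fun e => s (fter e) - s (forg e)) = \sum_w bd c w *: s w.
Proof.
move=> hc; transitivity (\sum_e c e *: s (fter e)).
  rewrite sum_oriented; apply: eq_bigr => e _.
  by rewrite hc scaleNr scalerBr -[in fter (finv e)]forg_inv finv_inv.
rewrite (partition_big (@fter X0) predT) //=; apply: eq_bigr => w _.
by rewrite scaler_suml; apply: eq_bigr => e /eqP ->.
Qed.

End Integration.

Section ChainInnerProduct.
Variables (R : realType) (X0 : fgraph).
Local Notation C := {ffun fedge X0 -> R}.
Implicit Types (c w : C) (W : set C).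

Lemma cdotC c w : cdot c w = cdot w c.
Proof. by congr (_ * _); apply: eq_bigr => e _; rewrite mulrC. Qed.

Lemma cdotDl c c' w : cdot (c + c') w = cdot c w + cdot c' w.
Proof.
rewrite /cdot -[RHS]mulrDr -big_split; apply: (congr1 ( *%R _)).
by apply: eq_bigr => e _; rewrite ffunE mulrDl.
Qed.

Lemma cdotZl a c w : cdot (a *: c) w = a * cdot c w.
Proof.
rewrite /cdot mulrCA [in RHS]big_distrr /=; apply: (congr1 ( *%R _)).
by apply: eq_bigr => e _; rewrite ffunE mulrA.
Qed.

Lemma cdotNl c w : cdot (- c) w = - cdot c w.
Proof. by rewrite -scaleN1r cdotZl mulN1r. Qed.

Lemma cdotBl c c' w : cdot (c - c') w = cdot c w - cdot c' w.
Proof. by rewrite cdotDl cdotNl. Qed.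

Lemma cdot0l w : cdot 0 w = 0.
Proof. by rewrite -(scale0r w) cdotZl mul0r. Qed.

Lemma cdot_suml (I : Type) (r : seq I) (P : pred I) (F : I -> C) w :
  cdot (\sum_(i <- r | P i) F i) w = \sum_(i <- r | P i) cdot (F i) w.
Proof. exact: (big_morph (fun c => cdot c w) (fun c c' => cdotDl c c' w) (cdot0l w)). Qed.

Lemma cdot_eq0 c : cdot c c = 0 -> c = 0.
Proof.
move=> /eqP; rewrite mulf_eq0 invr_eq0 pnatr_eq0 /= psumr_eq0; last first.
  by move=> e _; rewrite -expr2 sqr_ge0.
move=> /allP c0; apply/ffunP => e; rewrite ffunE.
by have := c0 e (mem_index_enum e); rewrite /= mulf_eq0 orbb => /eqP.
Qed.

Lemma cdot_integral c w : is_chain c -> is_chain w ->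
  cdot c w = \sum_(e | oriented e) c e * w e.
Proof.
move=> hc hw; rewrite /cdot sum_oriented big_distrr; apply: eq_bigr => e _.
by rewrite /= hc hw; field.
Qed.

Lemma cdot_chain1 e w : is_chain w -> cdot (chain1 R e) w = w e.
Proof.
move=> hw; rewrite cdot_integral //; last exact: chain1_chain.
exact: (@integral_chain1 X0 R R^o e w hw).
Qed.

Definition lin_closed W := W 0 /\ forall a x y, W x -> W y -> W (a *: x + y).

Lemma lin_closed_orthogonal c : lin_closed [set w | cdot c w = 0].
Proof.
split=> [|a x y /= cx cy]; first by rewrite /= cdotC cdot0l.
by rewrite cdotC cdotDl cdotZl !(cdotC _ c) cx cy mulr0 addr0.
Qed.

(** Gram-Schmidt.  The span of zs is described as the intersection of the subspaces
that contain zs. *)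
Lemma orth_proj_span (zs : seq C) c : exists w,
  (forall W, lin_closed W -> (forall z, z \in zs -> W z) -> W w) /\
  forall z, z \in zs -> cdot (c - w) z = 0.
Proof.
elim: zs c => [|z zs IH] c; first by exists 0; split => // W [].
have [w [wspan cw]] := IH c; have [pz [pzspan zpz]] := IH z.
pose z' := z - pz; pose k := cdot c z' / cdot z' z'.
have wz' : cdot z' w = 0 by exact: (wspan _ (lin_closed_orthogonal z')).
exists (k *: z' + w); split=> [W WL zsW|].
  have zsW' t : t \in zs -> W t by move=> h; apply: zsW; rewrite inE h orbT.
  have Wz' : W z'.
    rewrite /z' addrC -scaleN1r; apply: WL.2; first exact: pzspan.
    by apply: zsW; rewrite inE eqxx.
  by apply: WL.2 => //; exact: wspan.
have zs0 t : t \in zs -> cdot (c - (k *: z' + w)) t = 0.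
  move=> tzs; rewrite opprD addrCA cdotDl cw // addr0 cdotNl cdotZl zpz //.
  by rewrite mulr0 oppr0.
have z'0 : cdot (c - (k *: z' + w)) z' = 0.
  rewrite cdotBl cdotDl cdotZl (cdotC w) wz' addr0 /k.
  have [h|h] := eqVneq (cdot z' z') 0; last by rewrite divfK // subrr.
  by rewrite h mulr0 subr0 (cdot_eq0 h) cdotC cdot0l.
move=> t; rewrite inE => /orP [/eqP ->|]; last exact: zs0.
have zE : z = z' + pz by rewrite subrK.
rewrite zE cdotC cdotDl !(cdotC _ (c - _)) z'0 add0r.
exact: (pzspan _ (lin_closed_orthogonal _)).
Qed.

End ChainInnerProduct.

(** * The maximal abelian cover over the skeleton *)

Lemma sval_inj (A : Type) (P : A -> Prop) (x y : sig P) : sval x = sval y -> x = y.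
Proof. by case: x y => [x h] [y k] /= E; apply: eq_exist. Qed.

Section Homology.
Context {R : realType} {d : nat}.
Variables (T : triangulation R d) (B : 'M[R]_d).
Hypothesis Bu : B \in unitmx.
Hypothesis shiftT : forall z s, T s -> T (act_simplex (fun x => x + lat B z) s).

Local Notation X := (skeleton T).
Local Notation X0 := (quotient_graph Bu shiftT).
Local Notation E0 := (fedge X0).
Local Notation p := (qproj Bu shiftT).
Local Notation lat := (lat B).
Local Notation fl := (lat_floor B).
Local Notation CZ := {ffun E0 -> int}.
Local Notation CR := {ffun E0 -> R}.
Implicit Types (e : E0) (c h : CZ).

Definition edge_pair e : 'rV[R]_d * 'rV[R]_d := val (e : qedge T B).

(** The lattice coordinates of the cell that contains the end of the lift of e
starting in the fundamental domain. *)
Definition jump e : 'rV[int]_d := fl (edge_pair e).2.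

Definition edge_vector e : 'rV[R]_d := (edge_pair e).2 - (edge_pair e).1.

Definition rep (w : fvert X0) : 'rV[R]_d := val (w : qvert T B).

Lemma edge_pair_inv e :
  edge_pair (finv e) = ((edge_pair e).2 - lat (jump e), (edge_pair e).1 - lat (jump e)).
Proof. by []. Qed.

Lemma fl_edge_pair e : fl (edge_pair e).1 = 0.
Proof. exact: qedge_fl. Qed.

Lemma jump_inv e : jump (finv e) = - jump e.
Proof.
by rewrite {1}/jump edge_pair_inv /= -latN lat_floorD // fl_edge_pair add0r.
Qed.

Lemma edge_vector_inv e : edge_vector (finv e) = - edge_vector e.
Proof.
by rewrite /edge_vector edge_pair_inv /= !opprB addrA subrK.
Qed.

(** Up to the gradient of the vertex positions, the edge vectors are lattice
vectors; so a cycle is displaced by the lattice vector that adds up its jumps. *)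
Lemma edge_vectorE e : edge_vector e = rep (fter e) - rep (forg e) + lat (jump e).
Proof.
have -> : rep (forg e) = (edge_pair e).1.
  exact: (red_id (fl_edge_pair e)).
have -> : rep (fter e) = (edge_pair e).2 - lat (jump e) by [].
by rewrite /edge_vector addrAC subrK.
Qed.

(** For a cycle, the lattice coordinates of the translation between the two ends of
its lifts. *)
Definition displacement c : 'rV[int]_d := integral c jump.

Lemma displacementD c h : displacement (c + h) = displacement c + displacement h.
Proof. exact: integralDl. Qed.

Lemma displacement_chain1 e : displacement (chain1 int e) = jump e.
Proof. exact: (integral_chain1 _ jump_inv). Qed.

Definition real_chain c : CR := [ffun e => (c e)%:~R].

Lemma real_chain_integral c :
  integral (real_chain c) (fun e => lat (jump e)) = lat (displacement c).
Proof.
rewrite /displacement /integral.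
rewrite (big_morph lat (fun x y => latD B x y) (lat0 B)); apply: eq_bigr => e _.
by rewrite ffunE /lat map_mxZ scalemxAl.
Qed.

Lemma real_chainD c h : real_chain (c + h) = real_chain c + real_chain h.
Proof. by apply/ffunP => e; rewrite !ffunE intrD. Qed.

Lemma real_chainN c : real_chain (- c) = - real_chain c.
Proof. by apply/ffunP => e; rewrite !ffunE intrN. Qed.

Lemma real_chain_chain1 e : real_chain (chain1 int e) = chain1 R e.
Proof.
by apply/ffunP => e'; rewrite !ffunE intrB; congr (_ - _); case: (_ == _).
Qed.

Lemma bdN (A : comPzRingType) (c : {ffun E0 -> A}) w : bd (- c) w = - bd c w.
Proof. by rewrite /bd -sumrN; apply: eq_bigr => e _; rewrite ffunE. Qed.

Lemma real_chain_bd c w : bd (real_chain c) w = (bd c w)%:~R.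
Proof. by rewrite /bd rmorph_sum; apply: eq_bigr => e _; rewrite ffunE. Qed.

Lemma is_chainN (A : comPzRingType) (c : {ffun E0 -> A}) : is_chain c -> is_chain (- c).
Proof. by move=> hc e; rewrite !ffunE hc. Qed.

Lemma real_is_chain c : is_chain c -> is_chain (real_chain c).
Proof. by move=> hc e; rewrite !ffunE hc intrN. Qed.

Lemma real_H1 c : @H1 int X0 c -> @H1 R X0 (real_chain c).
Proof.
move=> [hc hb]; split; first exact: real_is_chain.
by move=> w; rewrite real_chain_bd hb.
Qed.

Lemma real_cycle_vector (c : CR) : @H1 R X0 c ->
  integral c edge_vector = integral c (fun e => lat (jump e)).
Proof.
move=> [hc hb].
have -> : edge_vector = (fun e => (rep (fter e) - rep (forg e)) + lat (jump e)).
  by apply/funext => e; exact: edge_vectorE.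
rewrite /integral; under eq_bigr do rewrite scalerDr; rewrite big_split /=.
have := integral_gradient rep hc; rewrite /integral => ->.
by rewrite big1 ?add0r // => w _; rewrite hb scale0r.
Qed.

Lemma cycle_vector c : @H1 int X0 c ->
  integral (real_chain c) edge_vector = lat (displacement c).
Proof. by move=> /real_H1 /real_cycle_vector ->; exact: real_chain_integral. Qed.

(** The cycles whose lifts to the skeleton are closed. *)
Definition vanishing : set CZ := [set h | @H1 int X0 h /\ displacement h = 0].

Variable u0 : vert X.
Let b : fvert X0 := mv p u0.

Lemma rep_vert (w : fvert X0) : T [fset rep w]%fset.
Proof. by have /(qvertP T Bu) [] := valP (w : qvert T B). Qed.

Definition rep_vertex (w : fvert X0) : vert X := exist _ (rep w) (rep_vert w).

Definition rep_edge e : edge X := exist _ (edge_pair e) (qedge_edge Bu e).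

(** The end of the lift, from the base vertex, of a path with the chain (sval x).2.
The displacement is a function of the chain alone, so no path has to be chosen. *)
Definition ab_to_vert (x : vert (maxab b)) : vert X :=
  shift_vert shiftT (displacement (sval x).2) (rep_vertex (sval x).1).

Definition ab_to_edge (x : edge (maxab b)) : edge X :=
  shift_edge shiftT (displacement (sval x).2) (rep_edge (sval x).1).

Lemma ab_to_org x : org (ab_to_edge x) = ab_to_vert (org x).
Proof.
apply: eq_exist; rewrite /=; congr (_ + _).
by rewrite -[LHS](red_id (fl_edge_pair _)).
Qed.

Lemma ab_to_ter x : ter (ab_to_edge x) = ab_to_vert (ter x).
Proof.
apply: eq_exist; rewrite /= displacementD displacement_chain1 latD addrA addrAC.
congr (_ + _); rewrite [rep _](_ : _ = (edge_pair (sval x).1).2 - lat (jump (sval x).1)) //.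
by rewrite subrK.
Qed.

Lemma ab_to_inv x : inv (ab_to_edge x) = ab_to_edge (inv x).
Proof.
apply: skel_edge_eq; first by rewrite org_inv ab_to_ter ab_to_org org_inv.
by rewrite -org_inv inv_inv ab_to_org ab_to_ter -[in RHS]org_inv inv_inv.
Qed.

Definition ab_to : gmor (maxab b) X := GMor ab_to_org ab_to_ter ab_to_inv.

Lemma ab_to_proj_vert x : mv p (ab_to_vert x) = (sval x).1.
Proof.
rewrite /= qproj_vert_shift //; apply: val_inj; apply: (red_id (B := B)).
by have /(qvertP T Bu) [] := valP ((sval x).1 : qvert T B).
Qed.

Lemma ab_to_proj_edge x : me p (ab_to_edge x) = (sval x).1.
Proof.
rewrite /= qproj_edge_shift //; apply: val_inj; apply: (red_pair_id (B := B)).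
exact: fl_edge_pair.
Qed.

Lemma ab_to_proj : gcomp p ab_to = ab_proj b.
Proof. by apply: gmor_ext => x; [exact: ab_to_proj_vert|exact: ab_to_proj_edge]. Qed.

Lemma base_path : @ab_path X0 b b 0.
Proof.
split=> [e|w]; first by rewrite !ffunE oppr0.
by rewrite /bd big1 ?subrr // => e _; rewrite ffunE.
Qed.

(** Both edges start at org g and lie over the same edge of the quotient. *)
Lemma ab_to_edge_lift x (g : edge X) : ab_to_vert x = org g ->
  exists f, ab_to_edge f = g.
Proof.
move=> xg; pose e : E0 := me p g.
have xe : forg e = (sval x).1 by rewrite -ab_to_proj_vert xg; exact: (mor_org p g).
have ex : @ab_path X0 b (forg e) (sval x).2 by rewrite xe; exact: (svalP x).
pose f : edge (maxab b) := exist (fun y => ab_path b (forg y.1) y.2) (e, (sval x).2) ex.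
have fx : org f = x.
  by apply: sval_inj; rewrite [RHS]surjective_pairing -xe.
exists f; have [_ /(_ (org g) e) []] := qproj_covering Bu shiftT; first exact: (mor_org p g).
move=> g' [_ uniq]; transitivity g'; last by apply: uniq; split.
apply/esym/uniq; split; first by rewrite ab_to_org fx.
exact: (ab_to_proj_edge f).
Qed.

(** Edge paths of the connected skeleton lift edge by edge. *)
Lemma ab_to_vert_surj u : exists x, ab_to_vert x = u.
Proof.
have [_ conn] := skeleton_connected T.
have base : exists x, ab_to_vert x = rep_vertex b.
  exists (exist (fun y => ab_path b y.1 y.2) (b, 0) base_path); apply: eq_exist.
  by rewrite /= /displacement integral0l lat0 addr0.
apply: (clos_refl_trans_invariant (P := fun v => exists x, ab_to_vert x = v) _
  (conn (rep_vertex b) u)) => //.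
move=> _ _ [g [<- <-]] [x /ab_to_edge_lift [f <-]].
by exists (ter f); rewrite ab_to_ter.
Qed.

Lemma ab_to_edge_surj g : exists f, ab_to_edge f = g.
Proof. by have [x /ab_to_edge_lift] := ab_to_vert_surj (org g). Qed.

Lemma ab_path_diff (w : fvert X0) c h : @ab_path X0 b w c -> @ab_path X0 b w h ->
  @H1 int X0 (h - c).
Proof.
move=> [hc cb] [hh hb]; split; first by apply: is_chainD => //; exact: is_chainN.
by move=> v; rewrite bdD bdN cb hb subrr.
Qed.

Lemma ab_path_add (w : fvert X0) c h : @ab_path X0 b w c -> @H1 int X0 h ->
  @ab_path X0 b w (c + h).
Proof.
move=> [hc cb] [hh hb]; split; first exact: is_chainD.
by move=> v; rewrite bdD cb hb addr0.
Qed.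

Definition ab_shift_vert h (hh : @H1 int X0 h) (x : vert (maxab b)) : vert (maxab b) :=
  exist (fun y => ab_path b y.1 y.2) ((sval x).1, (sval x).2 + h)
    (ab_path_add (svalP x) hh).

Definition ab_shift_edge h (hh : @H1 int X0 h) (x : edge (maxab b)) : edge (maxab b) :=
  exist (fun y => ab_path b (forg y.1) y.2) ((sval x).1, (sval x).2 + h)
    (ab_path_add (svalP x) hh).

Lemma ab_shift_org h (hh : @H1 int X0 h) x :
  org (ab_shift_edge hh x) = ab_shift_vert hh (org x).
Proof. exact: eq_exist. Qed.

Lemma ab_shift_ter h (hh : @H1 int X0 h) x :
  ter (ab_shift_edge hh x) = ab_shift_vert hh (ter x).
Proof. by apply: eq_exist; rewrite /= addrAC. Qed.

Lemma ab_shift_inv h (hh : @H1 int X0 h) x :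
  inv (ab_shift_edge hh x) = ab_shift_edge hh (inv x).
Proof. by apply: eq_exist; rewrite /= addrAC. Qed.

Definition ab_shift h (hh : @H1 int X0 h) : gmor (maxab b) (maxab b) :=
  GMor (ab_shift_org hh) (ab_shift_ter hh) (ab_shift_inv hh).

Lemma ab_shift_translation h (hh : vanishing h) : ab_translations vanishing (ab_shift hh.1).
Proof. by exists h. Qed.

(** Representatives lie in the fundamental domain, whose translates are disjoint. *)
Lemma shift_rep_inj w w' (z z' : 'rV[int]_d) :
  rep w + lat z = rep w' + lat z' -> w = w' /\ z = z'.
Proof.
have fl0 (v : fvert X0) : fl (rep v) = 0 by have /(qvertP T Bu) [] := valP (v : qvert T B).
move=> E; have := congr1 fl E; rewrite !lat_floorD // !fl0 !add0r => zz; split=> //.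
by apply: val_inj; move: E; rewrite zz => /addIr.
Qed.

(** Two vertices of the maximal abelian cover with the same image lie over the same
vertex and have chains with the same displacement; these differ by a cycle with
displacement 0. *)
Lemma ab_to_quotient : quotient_map (ab_translations vanishing) ab_to.
Proof.
split; [exact: ab_to_vert_surj|exact: ab_to_edge_surj|..].
- move=> x x'; split=> [xx|[f [h [_ h0] [fv _]] <-]]; last first.
    apply: eq_exist; rewrite /= fv /=.
    by rewrite displacementD h0 addr0.
  have [w0 d0] := shift_rep_inj (congr1 (@sval _ _) xx : _ = _ :> 'rV[R]_d).
  have hh : vanishing ((sval x').2 - (sval x).2).
    split; last by rewrite displacementD -d0 /displacement integralNl subrr.
    by apply: (@ab_path_diff (sval x).1); [exact: (svalP x)|rewrite w0; exact: (svalP x')].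
  exists (ab_shift hh.1); first exact: ab_shift_translation.
  case: x x' xx w0 d0 hh => [[w c] P] [[w' c'] P'] /= _ w0 _ hh; apply: eq_exist.
  by rewrite /= w0 addrC subrK.
- move=> x x'; split=> [xx|[f [h [_ h0] [_ fe]] <-]]; last first.
    apply: eq_exist; rewrite /= fe /=.
    by rewrite displacementD h0 addr0.
  have ee : (sval x).1 = (sval x').1.
    have := congr1 (me p) xx.
    by rewrite !ab_to_proj_edge.
  have d0 : displacement (sval x).2 = displacement (sval x').2.
    have := congr1 (fun g : edge X => (sval g).1) xx; rewrite /= ee => /addrI.
    exact: lat_inj.
  have hh : vanishing ((sval x').2 - (sval x).2).
    split; last by rewrite displacementD -d0 /displacement integralNl subrr.
    by apply: (@ab_path_diff (forg (sval x).1)); [exact: (svalP x)|rewrite ee; exact: (svalP x')].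
  exists (ab_shift hh.1); first exact: ab_shift_translation.
  case: x x' xx ee d0 hh => [[w c] P] [[w' c'] P'] /= _ w0 _ hh; apply: eq_exist.
  by rewrite /= w0 addrC subrK.
Qed.

(** The base vertex and its translate by z are joined by a path, which projects to a
cycle. *)
Lemma displacement_surj (z : 'rV[int]_d) : exists2 h, @H1 int X0 h & displacement h = z.
Proof.
have [x xz] := ab_to_vert_surj (shift_vert shiftT z (rep_vertex b)).
have [w0 d0] := shift_rep_inj (congr1 (@sval _ _) xz : _ = _ :> 'rV[R]_d).
exists (sval x).2 => //.
have := @ab_path_diff b 0 (sval x).2 base_path; rewrite subr0; apply.
by move: (svalP x); rewrite /= w0.
Qed.

Lemma displacement0 : displacement 0 = 0.
Proof. exact: integral0l. Qed.

Lemma displacementB c h : displacement (c - h) = displacement c - displacement h.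
Proof. by rewrite displacementD /displacement integralNl. Qed.

Lemma H1_subgroup : subgroup (@H1 int X0).
Proof.
split.
  split=> [e|w]; first by rewrite !ffunE oppr0.
  by rewrite /bd big1 // => e _; rewrite ffunE.
move=> c h [hc cb] [hh hb]; split; first by apply: is_chainD => //; exact: is_chainN.
by move=> w; rewrite bdD bdN cb hb subrr.
Qed.

Lemma vanishing_is_subgroup : subgroup vanishing.
Proof.
split; first by split; [exact: H1_subgroup.1|exact: displacement0].
move=> c h [c1 c0] [h1 h0]; split; first exact: H1_subgroup.2.
by rewrite displacementB c0 h0 subrr.
Qed.

Lemma displacement_section : exists k : 'I_d -> CZ, forall i,
  @H1 int X0 (k i) /\ displacement (k i) = delta_mx 0 i.
Proof.
have /choice [k kP] i : exists k, @H1 int X0 k /\ displacement k = delta_mx 0 i.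
  by have [k k1 k2] := displacement_surj (delta_mx 0 i); exists k.
by exists k.
Qed.

Definition section_sum (k : 'I_d -> CZ) (z : 'rV[int]_d) : CZ := \sum_i k i *~ z 0 i.

Lemma section_sum_displacement k z :
  (forall i, @H1 int X0 (k i) /\ displacement (k i) = delta_mx 0 i) ->
  displacement (section_sum k z) = z.
Proof.
move=> kP; rewrite /section_sum (big_morph displacement displacementD displacement0).
rewrite [RHS]row_sum_delta; apply: eq_bigr => i _.
by rewrite (morph_mulrz displacementD) (kP i).2 -[in RHS](intz (z 0 i)) scaler_int.
Qed.

Lemma section_sum_H1 k z :
  (forall i, @H1 int X0 (k i) /\ displacement (k i) = delta_mx 0 i) ->
  @H1 int X0 (section_sum k z).
Proof.
move=> kP; apply: (subgroup_sum H1_subgroup) => i _.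
by apply: (subgroupMz H1_subgroup); exact: (kP i).1.
Qed.

(** Displacement maps the cycles onto a free group, so its kernel has a complement,
spanned by cycles k_i that map to the standard basis. *)
Lemma vanishing_summand : direct_summand (@H1 int X0) vanishing.
Proof.
have [k kP] := displacement_section.
split; [exact: vanishing_is_subgroup|by move=> h []|].
have sB z z' : section_sum k z - section_sum k z' = section_sum k (z - z').
  by rewrite -sumrB; apply: eq_bigr => i _; rewrite !mxE mulrzBr.
exists (range (section_sum k)); split.
- split; first by exists 0 => //; rewrite /section_sum big1 // => i _; rewrite mxE mulr0z.
  by move=> _ _ [z _ <-] [z' _ <-]; rewrite sB; exists (z - z').
- by move=> _ [z _ <-]; exact: section_sum_H1.
- apply/seteqP; split=> [h [[_ h0] [z _ zh]]|_ ->].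
    move: h0; rewrite -zh section_sum_displacement // => ->.
    by rewrite /section_sum big1 // => i _; rewrite mxE mulr0z.
  split; first exact: vanishing_is_subgroup.1.
  by exists 0 => //; rewrite /section_sum big1 // => i _; rewrite mxE mulr0z.
- move=> c c1; exists (c - section_sum k (displacement c)), (section_sum k (displacement c)).
  split; [|by exists (displacement c)|by rewrite subrK].
  split; first by apply: H1_subgroup.2 => //; exact: section_sum_H1.
  by rewrite displacementB section_sum_displacement // subrr.
Qed.

Lemma vanishing_is_vanishing_subgroup : vanishing_subgroup p vanishing.
Proof.
split; first exact: vanishing_summand.
by exists b, ab_to; split; [exact: ab_to_proj|exact: ab_to_quotient].
Qed.

End Homology.

(** * From balanced tight frames to standard realizations *)

Section Standard.
Context {R : realType} {d : nat}.
Variables (T : triangulation R d) (B : 'M[R]_d).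
Hypothesis Bu : B \in unitmx.
Hypothesis shiftT : forall z s, T s -> T (act_simplex (fun x => x + lat B z) s).

Local Notation X := (skeleton T).
Local Notation X0 := (quotient_graph Bu shiftT).
Local Notation E0 := (fedge X0).
Local Notation p := (qproj Bu shiftT).
Local Notation lat := (lat B).
Local Notation CZ := {ffun E0 -> int}.
Local Notation CR := {ffun E0 -> R}.
Local Notation vec := (@edge_vector R d T B Bu shiftT).
Local Notation displ := (@displacement R d T B Bu shiftT).
Local Notation H := (@vanishing R d T B Bu shiftT).
Local Notation rc := (@real_chain R d T B Bu shiftT).
Local Notation HP := (@orth_compl R X0 H).
Implicit Types (c w : CR) (h : CZ) (e : E0).

Variable k : R.
Hypothesis k_gt0 : 0 < k.
Hypothesis harmonic : forall w : fvert X0, \sum_(e | fter e == w) vec e = 0.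
Hypothesis tight_frame : forall i j : 'I_d,
  k ^+ 2 * (\sum_(e : E0) vec e 0 i * vec e 0 j) = 2 * (i == j)%:R.

(** The factor k makes these chains orthonormal. *)
Definition frame_chain (i : 'I_d) : CR := [ffun e => k * vec e 0 i].

Lemma frame_chain_odd i : is_chain (frame_chain i).
Proof. by move=> e; rewrite !ffunE edge_vector_inv mxE mulrN. Qed.

Lemma frame_chain_H1 i : @H1 R X0 (frame_chain i).
Proof.
split=> [|w]; first exact: frame_chain_odd.
rewrite /bd; under eq_bigr do rewrite ffunE.
have := congr1 (fun x : 'rV[R]_d => x 0 i) (harmonic w).
by rewrite -mulr_sumr summxE mxE => ->; rewrite mulr0.
Qed.

Lemma cdot_frame_chain c i : is_chain c ->
  cdot c (frame_chain i) = k * (integral c vec) 0 i.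
Proof.
move=> hc; rewrite cdot_integral //; last exact: frame_chain_odd.
rewrite /integral summxE mulr_sumr; apply: eq_bigr => e _.
by rewrite ffunE [in RHS]mxE mulrCA.
Qed.

Lemma frame_chain_orthonormal i j :
  cdot (frame_chain i) (frame_chain j) = (i == j)%:R.
Proof.
rewrite /cdot (eq_bigr (fun e => k ^+ 2 * (vec e 0 i * vec e 0 j))); last first.
  by move=> e _; rewrite !ffunE mulrACA expr2.
by rewrite -mulr_sumr tight_frame mulKf // pnatr_eq0.
Qed.

Lemma real_H1_lin_closed : lin_closed (@H1 R X0).
Proof.
split=> [|a x y [xc xb] [yc yb]].
  split=> [e|w]; first by rewrite !ffunE oppr0.
  by rewrite /bd big1 // => e _; rewrite ffunE.
split=> [e|w]; first by rewrite !ffunE xc yc scalerN opprD.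
rewrite bdD yb addr0 /bd; under eq_bigr do rewrite ffunE.
by have := xb w; rewrite /bd -scaler_sumr => ->; rewrite scaler0.
Qed.

Lemma real_span_orthogonal_frame c i : real_span H c -> cdot c (frame_chain i) = 0.
Proof.
move=> [n [r [h [hH ->]]]]; rewrite cdot_suml big1 // => j _.
have [hj1 hj0] := hH j; rewrite cdotZl cdot_frame_chain; last exact: (real_H1 hj1).1.
by rewrite (cycle_vector hj1) hj0 lat0 mxE !mulr0.
Qed.

Lemma frame_chain_compl i : HP (frame_chain i).
Proof.
split; first exact: frame_chain_H1.
by move=> c /real_span_orthogonal_frame; rewrite cdotC.
Qed.

Lemma real_span_sum (I : finType) (r : I -> R) (h : I -> CZ) :
  (forall i, H (h i)) -> real_span H (\sum_i r i *: rc (h i)).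
Proof.
move=> hH; exists #|I|, (r \o enum_val), (h \o enum_val); split=> // [i|].
  exact: hH.
by rewrite (reindex _ (onW_bij _ (@enum_val_bij I))).
Qed.

(** Fix chains g w of paths from a base vertex to each vertex w, and close up each
edge e to the cycle z e = g (o e) + e - g (t e).  In the combination of the z e with
the coefficients of a cycle, the chains g cancel by the Stokes formula. *)
Lemma integral_cycles_span (u0 : vert X) : exists z : E0 -> CZ,
  (forall e, @H1 int X0 (z e)) /\
  forall c, @H1 R X0 c -> c = \sum_(e | oriented e) c e *: rc (z e).
Proof.
have /choice [g gP] : forall w : fvert X0, exists g : CZ, ab_path (mv p u0) w g.
  move=> w; have [x xw] := ab_to_vert_surj Bu shiftT u0 (rep_vertex w).
  exists (sval x).2; have := svalP x; have := ab_to_proj_vert x; rewrite xw => <-.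
  suff -> : mv p (rep_vertex w) = w by [].
  apply: val_inj; apply: (red_id (B := B)).
  by have /(qvertP T Bu) [] := valP (w : qvert T B).
pose z e : CZ := g (forg e) + chain1 int e - g (fter e).
have zH1 e : @H1 int X0 (z e).
  exact: (ab_path_diff (gP (fter e)) (ab_path_ter (gP (forg e)))).
exists z; split=> // c [hc cb].
have c1 : c = \sum_(e | oriented e) c e *: chain1 R e.
  apply/ffunP => f; rewrite sum_ffunE.
  have := @integral_chain1 X0 R R^o f c hc.
  rewrite /integral => <-; apply: eq_bigr => e _.
  rewrite !ffunE /= /GRing.scale /= mulrC (eq_sym f e); congr (_ * (_ - _%:R)).
  by rewrite eq_sym (can2_eq (@finv_inv X0) (@finv_inv X0)).
have cz e : rc (z e) = chain1 R e - (rc (g (fter e)) - rc (g (forg e))).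
  by rewrite /z !real_chainD real_chainN real_chain_chain1 opprB addrCA addrA.
rewrite {1}c1; under [RHS]eq_bigr do rewrite cz scalerBr.
rewrite sumrB -[LHS]subr0; congr (_ - _).
have := integral_gradient (fun v => rc (g v)) hc; rewrite /integral => ->.
by rewrite big1 // => w _; rewrite cb scale0r.
Qed.

(** Write the integral cycles z e that span the real cycles as h e plus a combination
of cycles displaced by the basis vectors of the lattice, with h e in H.  If c is
orthogonal to the frame chains, its displacement is 0, and as the basis vectors of
the lattice are independent over the reals, only the part in H remains. *)
Lemma orth_frame_real_span (u0 : vert X) c : @H1 R X0 c ->
  (forall i, cdot c (frame_chain i) = 0) -> real_span H c.
Proof.
move=> c1 c0.
have [z [zH1 cz]] := integral_cycles_span u0.
have [s sP] := displacement_section Bu shiftT u0.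
pose h e := z e - section_sum s (displ (z e)).
have hH e : H (h e).
  split; first by apply: (H1_subgroup Bu shiftT).2 => //; exact: section_sum_H1.
  by rewrite displacementB section_sum_displacement // subrr.
have dispv : \sum_(e | oriented e) c e *: lat (displ (z e)) = 0.
  apply/rowP => i; rewrite [RHS]mxE; apply: (mulfI (lt0r_neq0 k_gt0)).
  rewrite mulr0 -(c0 i) {2}(cz c c1) cdot_suml summxE mulr_sumr.
  apply: eq_bigr => e _; rewrite cdotZl cdot_frame_chain; last exact: (real_H1 (zH1 e)).1.
  by rewrite (cycle_vector (zH1 e)) [in LHS]mxE mulrCA.
have disp0 : \sum_(e | oriented e) c e *: map_mx intr (displ (z e)) = 0 :> 'rV[R]_d.
  have Bf : row_free B by rewrite row_free_unit.
  apply: (row_free_inj Bf); rewrite mul0mx mulmx_suml -[RHS]dispv.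
  by apply: eq_bigr => e _; rewrite scalemxAl.
have rcMz g n : rc (g *~ n) = n%:~R *: rc g.
  by rewrite (morph_mulrz (@real_chainD _ _ _ _ _ _)) scaler_int.
have rcs e : rc (section_sum s (displ (z e))) =
    \sum_i (displ (z e) 0 i)%:~R *: rc (s i).
  rewrite /section_sum (big_morph rc (@real_chainD _ _ _ _ _ _) (_ : rc 0 = 0)); last first.
    by apply/ffunP => f; rewrite !ffunE.
  by apply: eq_bigr => i _; rewrite rcMz.
have -> : c = \sum_e (if oriented e then c e else 0) *: rc (h e).
  rewrite (eq_bigr (fun e => if oriented e then c e *: rc (h e) else 0)); last first.
    by move=> e _; case: ifP => // _; rewrite scale0r.
  rewrite -big_mkcond {1}(cz c c1).
  have s0 : \sum_(e | oriented e) c e *: rc (section_sum s (displ (z e))) = 0.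
    under eq_bigr do rewrite rcs scaler_sumr.
    rewrite exchange_big big1 // => i _ /=.
    under eq_bigr do rewrite scalerA.
    rewrite -scaler_suml -[RHS](scale0r (rc (s i))); congr (_ *: _).
    have := congr1 (fun x : 'rV[R]_d => x 0 i) disp0; rewrite summxE [RHS]mxE => si0.
    by rewrite -[RHS]si0; apply: eq_bigr => e _; rewrite !mxE.
  transitivity (\sum_(e | oriented e) c e *: rc (z e) -
    \sum_(e | oriented e) c e *: rc (section_sum s (displ (z e)))).
    by rewrite s0 subr0.
  rewrite -sumrB; apply: eq_bigr => e _.
  by rewrite -scalerBr /h real_chainD real_chainN.
exact: real_span_sum.
Qed.

Lemma orth_compl_lin_closed : lin_closed HP.
Proof.
split; first by split; [exact: real_H1_lin_closed.1|move=> h _; exact: cdot0l].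
move=> a x y [x1 xo] [y1 yo]; split; first exact: real_H1_lin_closed.2.
by move=> h hh; rewrite cdotDl cdotZl xo // yo // mulr0 addr0.
Qed.

Lemma lin_closed_sum (W : set CR) n (a : 'I_n -> R) (F : 'I_n -> CR) : lin_closed W ->
  (forall i, W (F i)) -> W (\sum_i a i *: F i).
Proof.
move=> [W0 WL] WF; elim/big_rec: _ => // i x _ Wx; exact: WL.
Qed.

(** The component of w orthogonal to the frame chains lies in the real span of H and
is orthogonal to it, so it is 0. *)
Lemma frame_chain_basis (u0 : vert X) : orthonormal_basis HP frame_chain.
Proof.
split; [exact: frame_chain_compl|exact: frame_chain_orthonormal|].
move=> w ww; exists (fun i => cdot w (frame_chain i)).
set w' := \sum_i _; have w'c : HP w'.
  by apply: (lin_closed_sum _ orth_compl_lin_closed); exact: frame_chain_compl.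
have dc : HP (w - w').
  by rewrite addrC -scaleN1r; exact: orth_compl_lin_closed.2.
apply/eqP; rewrite -subr_eq0; apply/eqP/cdot_eq0.
apply: dc.2; apply: (orth_frame_real_span u0 dc.1) => i.
rewrite cdotBl /w' cdot_suml (bigD1 i) //= cdotZl frame_chain_orthonormal eqxx mulr1.
rewrite big1 ?addr0 ?subrr // => j /negPf ji.
by rewrite cdotZl frame_chain_orthonormal ji mulr0.
Qed.

(** Existence of one orthogonal projection makes orth_proj a projection, and then
orthogonal projection preserves inner products with the elements of W. *)
Lemma orth_projP (W : set CR) c w : W w -> (forall w', W w' -> cdot (c - w) w' = 0) ->
  forall w', W w' -> cdot (orth_proj W c - c) w' = 0.
Proof.
move=> Ww cw; rewrite /orth_proj; case: xgetP => [x -> [_ xc] w' Ww'|/(_ w) nP].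
  by rewrite -opprB cdotNl xc // oppr0.
by case: nP; split.
Qed.

(** The frame chains lie in both subspaces on which one projects, so neither
projection changes the inner product with them, and the coordinates of the
projected edge are those of the edge itself. *)
Lemma standard_cochainE (u0 : vert X) e : standard_cochain H frame_chain e = k *: vec e.
Proof.
apply/rowP => i; rewrite [LHS]mxE [RHS]mxE.
have [z [zH1 cz]] := integral_cycles_span u0.
have proj1 c : cdot (orth_proj (@H1 R X0) c) (frame_chain i) = cdot c (frame_chain i).
  have [w [wspan cw]] := orth_proj_span [seq rc (z e) | e <- enum E0] c.
  apply/eqP; rewrite -subr_eq0 -cdotBl; apply/eqP.
  apply: (orth_projP (w := w)); last exact: frame_chain_H1.
    apply: wspan; first exact: real_H1_lin_closed.
    by move=> _ /mapP [f _ ->]; exact: real_H1.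
  move=> w' /cz ->; rewrite cdotC cdot_suml big1 // => f _.
  rewrite cdotZl cdotC cw ?mulr0 //.
  by apply/mapP; exists f; rewrite ?mem_enum.
have proj2 c : cdot (orth_proj HP c) (frame_chain i) = cdot c (frame_chain i).
  apply/eqP; rewrite -subr_eq0 -cdotBl; apply/eqP.
  have [_ uo uspan] := frame_chain_basis u0.
  apply: (orth_projP (w := \sum_j cdot c (frame_chain j) *: frame_chain j)).
  - by apply: (lin_closed_sum _ orth_compl_lin_closed); exact: frame_chain_compl.
  - move=> w' /uspan [a ->]; rewrite cdotC cdot_suml big1 // => j _.
    rewrite cdotZl cdotC cdotBl cdot_suml (bigD1 j) //= cdotZl uo eqxx mulr1.
    rewrite big1 ?addr0 ?subrr ?mulr0 // => l /negPf lj.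
    by rewrite cdotZl uo lj mulr0.
  - exact: frame_chain_compl.
rewrite proj2 proj1 cdot_chain1; last exact: frame_chain_odd.
by rewrite ffunE.
Qed.

(** In the orthonormal basis of frame chains the standard cochain is k times the
building cochain of the inclusion. *)
Lemma scaled_inclusion_standard (u0 : vert X) :
  normalized_standard_realization p (fun x : vert X => k *: inclusion x).
Proof.
split.
  exists (fun f => k *: (inclusion (mv f u0) - inclusion u0)).
  have deckE f : deck p f -> exists z, f = shift shiftT z.
    by rewrite (deck_translations Bu shiftT) => /translations_shift [z <-]; exists z.
  have rhoE z : inclusion (mv (shift shiftT z) u0) - inclusion u0 = lat z.
    by rewrite (shift_is_translation shiftT z) addrAC subrr add0r.
  split.
  - move=> f g /deckE [z ->] /deckE [z' ->].
    by rewrite -shiftD !rhoE -scalerDr latD.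
  - move=> f g; rewrite !inE => /deckE [z ->] /deckE [z' ->].
    by rewrite !rhoE => /(scalerI (lt0r_neq0 k_gt0)) /(lat_inj Bu) ->.
  - exists (k *: B).
      move: Bu; rewrite !unitmxE detZ !unitfE => detB.
      by rewrite mulf_neq0 // expf_neq0 // lt0r_neq0.
    apply/seteqP; split=> [_ [f /deckE [z ->] <-]|_ [z _ <-]].
      by rewrite rhoE; exists z => //; rewrite -scalemxAr.
    exists (shift shiftT z); first exact: shift_deck.
    by rewrite rhoE -scalemxAr.
  - move=> f x /deckE [z ->]; by rewrite rhoE -scalerDr.
exists H, frame_chain; split.
- exact: vanishing_is_vanishing_subgroup.
- exact: frame_chain_basis u0.
- move=> e; rewrite (standard_cochainE u0) -scalerBr; congr (_ *: _).
  rewrite /edge_vector /edge_pair /=.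
  by rewrite /red opprB addrA subrK.
Qed.

Lemma inclusion_standard (u0 : vert X) : standard_realization p (@inclusion R d T).
Proof.
exists (fun x : vert X => k *: inclusion x), (fun y => k^-1 *: y); split.
- exact: scaled_inclusion_standard.
- exists k^-1; first by rewrite invr_gt0.
  move=> x y; rewrite /enorm -scalerBr dotZl dotZr mulrA -expr2 sqrtrM ?sqr_ge0 //.
  by rewrite sqrtr_sqr ger0_norm // invr_ge0 ltW.
- by apply/funext => x /=; rewrite scalerA mulVf ?scale1r // lt0r_neq0.
Qed.

End Standard.

(** * Edge vectors of a Coxeter complex *)

Section CoxeterSymmetry.
Context {R : realType} {d : nat}.
Variables (T : triangulation R d) (B : 'M[R]_d).
Hypothesis T_coxeter : coxeter_complex T.
Hypothesis Bu : B \in unitmx.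
Hypothesis latticeE : translation_lattice T = lattice B.

Lemma lattice_shift z s : T s -> T (act_simplex (fun x => x + lat B z) s).
Proof.
apply: T_coxeter.1; have : lattice B (lat B z) by exists z.
by rewrite -latticeE.
Qed.

Local Notation X := (skeleton T).
Local Notation X0 := (quotient_graph Bu lattice_shift).
Local Notation E0 := (fedge X0).
Local Notation lat := (lat B).
Local Notation vec := (@edge_vector R d T B Bu lattice_shift).
Implicit Types (e : E0) (g h : 'rV[R]_d -> 'rV[R]_d).

Lemma is_edge_image g (f : 'rV[R]_d * 'rV[R]_d) : Gamma T g ->
  is_edge T f -> is_edge T (g f.1, g f.2).
Proof.
move=> Gg [ne Tf]; have [h [_ gh _]] := Gamma_inverse Gg.
split; first by rewrite (inj_eq (can_inj gh)).
by have := T_coxeter.1 _ _ Gg Tf; rewrite /act_simplex imfset_fset2.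
Qed.

(** The group normalizes its translation lattice, so it acts on the edges of the
quotient graph. *)
Definition edge_act g (Gg : Gamma T g) e : E0 :=
  [` red_qedge Bu lattice_shift (is_edge_image Gg (qedge_edge Bu e))]%fset.

Lemma edge_actE g (Gg : Gamma T g) e :
  edge_pair (edge_act Gg e) = red_pair B (g (edge_pair e).1, g (edge_pair e).2).
Proof. by []. Qed.

Lemma lattice_linear_part g z : Gamma T g ->
  exists z', lat z *m linear_part g = lat z'.
Proof.
move=> Gg; have : translation_lattice T (lat z *m linear_part g).
  by apply: translation_linear_part => //; rewrite latticeE; exists z.
by rewrite latticeE => -[z' _ <-]; exists z'.
Qed.

Lemma edge_actK g h (Gg : Gamma T g) (Gh : Gamma T h) :
  cancel g h -> cancel (edge_act Gg) (edge_act Gh).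
Proof.
move=> gh e; apply: val_inj.
transitivity (edge_pair (edge_act Gh (edge_act Gg e))); first by [].
rewrite !edge_actE [red_pair _ (g _, g _)]red_pairE /=; set z := - _.
have [z' zz'] := lattice_linear_part z Gh.
have hE x : h (g x + lat z) = x + lat z'.
  have [hE _] := Gamma_isometry Gh.
  by rewrite hE mulmxDl zz' addrAC -hE gh.
rewrite !hE (red_pair_shift Bu z' (edge_pair e)) red_pair_id //.
exact: fl_edge_pair.
Qed.

Lemma edge_act_inj g (Gg : Gamma T g) : injective (edge_act Gg).
Proof.
have [h [Gh gh _]] := Gamma_inverse Gg.
exact: can_inj (edge_actK Gg Gh gh).
Qed.

Lemma edge_vector_act g (Gg : Gamma T g) e :
  vec (edge_act Gg e) = vec e *m linear_part g.
Proof.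
rewrite -(isometry_sub _ _ (Gamma_isometry Gg)) /edge_vector edge_actE red_pairE /=.
by rewrite opprD addrACA subrr addr0.
Qed.

Lemma linear_part_normal a (n : 'rV[R]_d) : n != 0 ->
  n *m linear_part (reflection a n) = - n.
Proof.
move=> n0; rewrite linear_part_reflection /lin_reflection mulfK ?dot_eq0 //.
by rewrite scaler_nat mulr2n opprD addrA subrr sub0r.
Qed.

Lemma reflection_fixed_orthogonal a (n y : 'rV[R]_d) :
  y *m linear_part (reflection a n) = y -> dot y n = 0.
Proof.
rewrite linear_part_reflection /lin_reflection => /eqP.
have [->|n0] := eqVneq n 0; first by rewrite dot0r.
rewrite subr_eq addrC -subr_eq subrr eq_sym scaler_eq0 (negPf n0) orbF.
by rewrite mulf_eq0 invr_eq0 dot_eq0 (negPf n0) orbF mulf_eq0 pnatr_eq0 /= => /eqP.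
Qed.

(** The reflections in the walls of a chamber that contain the vertex fix it and
permute the edges there, so the sum is orthogonal to the normals of these walls.  The
normals of the d + 1 walls add up to 0, so it is orthogonal to the last one as well. *)
Lemma star_balanced (w : fvert X0) : \sum_(e | forg e == w) vec e = 0.
Proof.
set Y := \sum_(e | _) _.
have [s tops ws] := vertex_in_top (rep_vert w).
have [nu [ca bary]] := barycentricP tops.
have Yw v : v \in s -> v != rep w -> dot Y (nu v) = 0.
  move=> vs vw; have [->|nuv] := eqVneq (nu v) 0; first exact: dot0r.
  have [a [Gr rfix]] := wall_reflection tops bary vs nuv.
  apply: (@reflection_fixed_orthogonal a); rewrite mulmx_suml.
  have org_act g (Gg : Gamma T g) e : g (rep w) = rep w ->
      forg e == w -> forg (edge_act Gg e) == w.
    move=> gw /eqP ew; apply/eqP/val_inj.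
    transitivity (red B (edge_pair (edge_act Gg e)).1); first by [].
    rewrite edge_actE red_pairE /= (red_shift Bu).
    have -> : (edge_pair e).1 = rep w.
      by rewrite -ew -[LHS](red_id (fl_edge_pair e)).
    rewrite gw red_id //.
    by have /(qvertP T Bu) [] := valP (w : qvert T B).
  have rw : reflection a (nu v) (rep w) = rep w by apply: rfix; rewrite // eq_sym.
  have [h [Gh rh hr]] := Gamma_inverse Gr.
  have hw : h (rep w) = rep w by rewrite -{1}rw rh.
  rewrite /Y [RHS](reindex_inj (@edge_act_inj _ Gr)); apply: eq_big => e.
    apply/idP/idP; first by move/(org_act _ Gr e rw).
    by move/(org_act _ Gh (edge_act Gr e) hw); rewrite (edge_actK Gr Gh rh).
  by rewrite edge_vector_act.
apply: (barycentric_span bary) => v vs; have [vw|] := eqVneq v (rep w); last exact: Yw.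
have [_ nu0 _ _ _] := bary; rewrite vw -[nu _](addrK (\sum_(v <- (s `\ rep w)%fset) nu v)).
rewrite -big_fsetD1 //= nu0 sub0r dotNr dotC dot_suml big1_fset ?oppr0 //= => x.
by rewrite !inE => /andP [xw xs] _; rewrite dotC Yw.
Qed.

Lemma harmonic (w : fvert X0) : \sum_(e | fter e == w) vec e = 0.
Proof.
transitivity (- \sum_(e | forg e == w) vec e); last by rewrite star_balanced oppr0.
rewrite (reindex_inj (can_inj (@finv_inv X0))) -sumrN; apply: eq_big => e.
  by rewrite -forg_inv finv_inv.
by rewrite edge_vector_inv.
Qed.

Definition frame_mx : 'M[R]_d := \sum_e (vec e)^T *m vec e.

Lemma frame_mx_sym : frame_mx^T = frame_mx.
Proof.
by rewrite /frame_mx linear_sum; apply: eq_bigr => e _; rewrite /= trmx_mul trmxK.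
Qed.

Lemma dot_frame y : dot (y *m frame_mx) y = \sum_e dot y (vec e) ^+ 2.
Proof.
rewrite /frame_mx mulmx_sumr dot_suml; apply: eq_bigr => e _.
rewrite mulmxA [y *m _]mx11_scalar -dotE mul_scalar_mx dotZl (dotC (vec e)).
by rewrite expr2.
Qed.

Lemma frame_mx_comm g : Gamma T g -> linear_part g *m frame_mx = frame_mx *m linear_part g.
Proof.
move=> Gg; set W := linear_part g; have WW : W *m W^T = 1%:M := (Gamma_isometry Gg).2.
have E : frame_mx = W^T *m frame_mx *m W.
  rewrite {1}/frame_mx (reindex_inj (@edge_act_inj _ Gg)) /=.
  rewrite mulmx_sumr mulmx_suml; apply: eq_bigr => e _.
  by rewrite edge_vector_act trmx_mul !mulmxA.
by rewrite {1}E !mulmxA WW mul1mx.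
Qed.

(** The frame operator commutes with the wall reflections of a chamber, so the wall
normals nu w are eigenvectors, with eigenvalues l w.  Applying it to the relation
that they add up to 0 gives a second relation with coefficients l w; pairing this one
with the difference of two vertices v and v' yields l v = l v'. *)
Lemma frame_mx_scalar : exists l, frame_mx = l%:M.
Proof.
have [s tops _] := tops_cover T 0; have [nu [ca bary]] := barycentricP tops.
have /choice [l lP] : forall w, exists l, w \in s -> nu w *m frame_mx = l *: nu w.
  move=> w; have [ws|] := boolP (w \in s); last by exists 0.
  have [n0|nuw] := eqVneq (nu w) 0; first by exists 0; rewrite n0 mul0mx scaler0.
  have [a [Gr _]] := wall_reflection tops bary ws nuw.
  set y := nu w *m frame_mx; exists (dot y (nu w) / dot (nu w) (nu w)) => _.
  have : y *m linear_part (reflection a (nu w)) = - y.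
    by rewrite /y -mulmxA -(frame_mx_comm Gr) mulmxA linear_part_normal // mulNmx.
  rewrite linear_part_reflection /lin_reflection => /eqP.
  rewrite subr_eq addrC -subr_eq opprK -mulr2n -scaler_nat -mulrA -scalerA.
  have two : (2 : R) != 0 by rewrite pnatr_eq0.
  by move=> /eqP /(scalerI two).
have [bE nu0 _ _ _] := bary.
have lE v v' : v \in s -> v' \in s -> l v = l v'.
  move=> vs vs'; apply/eqP; rewrite -subr_eq0.
  have sum0 : \sum_(w <- s) l w *: nu w = 0.
    transitivity ((\sum_(w <- s) nu w) *m frame_mx); last by rewrite nu0 mul0mx.
    by rewrite mulmx_suml; apply: eq_big_seq => w ws; rewrite lP.
  have lv u : u \in s -> dot u (\sum_(w <- s) l w *: nu w) = l u - \sum_(w <- s) l w * ca w.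
    move=> us; rewrite dotC dot_suml; apply/eqP; rewrite eq_sym subr_eq -big_split /=.
    rewrite (big_fsetD1 u) //= dotZl dotC -mulrDr bE // eqxx mulr1.
    rewrite big1_fset ?addr0 // => w; rewrite !inE => /andP [wu ws] _.
    by rewrite dotZl dotC -mulrDr bE // eq_sym (negPf wu) mulr0.
  have := lv v vs; have := lv v' vs'; rewrite sum0 !dot0r => lv' lvv.
  by rewrite (subr0_eq (esym lvv)) (subr0_eq (esym lv')) subrr.
have [v vs] : exists v, v \in s by apply/fset0Pn; exact: tri_neq0 tops.1.
exists (l v); apply/row_matrixP => i; rewrite !rowE; set y := delta_mx 0 i.
rewrite mul_mx_scalar; apply/eqP; rewrite -subr_eq0; apply/eqP.
apply: (barycentric_span bary) => w ws.
by rewrite dotBl dot_mulmx frame_mx_sym lP // (lE w v) // dotZl dotZr subrr.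
Qed.

(** An edge with vector x contributes |x|^4 to <x S, x>, where S is the frame
operator, and the other terms are squares. *)
Lemma frame_positive : (0 < d)%N -> exists2 l, 0 < l & frame_mx = l%:M.
Proof.
move=> d0; have [l lE] := frame_mx_scalar; exists l => //.
have [s [Ts sd] _] := tops_cover T 0.
have [v vs] : exists v, v \in s by apply/fset0Pn; exact: tri_neq0 Ts.
have [w] : exists w, w \in (s `\ v)%fset.
  by apply/fset0Pn; rewrite -cardfs_gt0; move: sd; rewrite (cardfsD1 v) vs add1n => -[->].
rewrite !inE => /andP [wv ws].
have fe : is_edge T (v, w).
  split; first by rewrite eq_sym.
  apply: (tri_face Ts); first by rewrite fsubUset !fsub1set vs.
  by apply/fset0Pn; exists v; rewrite !inE eqxx.
pose e : E0 := me (qproj Bu lattice_shift) (exist _ (v, w) fe).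
have vecE : vec e = w - v.
  by rewrite /edge_vector /edge_pair /= /red opprB addrA subrK.
have wv0 : 0 < dot (w - v) (w - v) by rewrite dot_gt0 subr_eq0.
have : 0 < dot ((w - v) *m frame_mx) (w - v).
  rewrite dot_frame (bigD1 e) //= vecE ltr_wpDr ?exprn_gt0 //.
  by apply: sumr_ge0 => f _; exact: sqr_ge0.
by rewrite lE mul_mx_scalar dotZl pmulr_lgt0.
Qed.

Lemma tight_frame : exists2 k : R, 0 < k & forall i j : 'I_d,
  k ^+ 2 * (\sum_(e : E0) vec e 0 i * vec e 0 j) = 2 * (i == j)%:R.
Proof.
have [d0|] := posnP d; first by exists 1 => // -[i hi]; exfalso; move: hi; rewrite d0.
move=> /frame_positive [l l0 lE]; exists (Num.sqrt (2 / l)).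
  by rewrite sqrtr_gt0 divr_gt0.
move=> i j; rewrite sqr_sqrtr ?divr_ge0 ?ltW //.
have -> : \sum_(e : E0) vec e 0 i * vec e 0 j = frame_mx i j.
  rewrite /frame_mx summxE; apply: eq_bigr => e _.
  by rewrite [RHS]mxE big_ord1 [_^T _ _]mxE.
by rewrite lE mxE -[X in _ * X]mulr_natr mulrA divfK // lt0r_neq0.
Qed.

End CoxeterSymmetry.

Theorem theorem7p3 (R : realType) (d : nat) (T : triangulation R d)
    (T_coxeter : coxeter_complex T) :
  exists L : set 'rV[R]_d,
    is_lattice L /\ translations_preserve T L /\
    exists (X0 : fgraph) (p : gmor (skeleton T) X0),
      quotient_map (translations T L) p /\
      topological_crystal d p /\
      deck p = translations T L /\
      standard_realization p (@inclusion R d T).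
Proof.
have Llat := translation_is_lattice T_coxeter; have [B Bu LE] := Llat.
have latticeE : translation_lattice T = lattice B := LE.
have [[u0] _] := skeleton_connected T.
pose shiftT := lattice_shift T_coxeter latticeE.
exists (lattice B); split; first by rewrite -latticeE.
split; first exact: (lattice_preserves shiftT).
exists (quotient_graph Bu shiftT), (qproj Bu shiftT).
split; first exact: qproj_quotient.
split; first exact: qproj_crystal.
split; first exact: deck_translations.
have [k k0 frame] := tight_frame T_coxeter Bu latticeE.
exact: (inclusion_standard k0 (@harmonic R d T B T_coxeter Bu latticeE) frame u0).
Qed.
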